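(* Let $V$ be a vector space of finite dimension $\ell$ over a field $\mathbf{K}$ of characteristic zero, and let $\Delta$ be a finite set of nonzero elements of $V^*$, no two of which are proportional. Then, as formal power series in $s,t$, $$\mathrm{Poin}(\overline{R}(\Delta),s,t)=\frac{1}{(1-s)^{\ell}}\,\mathrm{Poin}\left(\mathcal{A}(\Delta),\ \frac{t(1-s)}{1-t}\right).$$
   Context: Let $S=S(V^* )$ be the symmetric algebra of $V^*$, regarded as the ring of polynomial functions on $V$. Let $R=R(\Delta)=S[\Delta^{-1}]$ with $\Delta^{-1}=\{1/\alpha\mid\alpha\in\Delta\}$, i.e. the $\mathbf{K}$-algebra of rational functions on $V$ regular outside $\bigcup_{\alpha\in\Delta}\{\alpha=0\}$. For $p,q\in\mathbb{Z}$, let $R^p_q$ be the $\mathbf{K}$-linear span of all elements $f/g\in R$ with $f,g$ polynomials ($g\neq 0$), $\deg f\le p$ and $\deg g\le q$; $R^p_q=0$ if $p<0$ or $q<0$. Put $$\overline{R^p_q}=R^p_q/(R^{p-1}_q+R^p_{q-1}),\qquad \overline{R}(\Delta)=\bigoplus_{p,q}\overline{R^p_q},\qquad \mathrm{Poin}(\overline{R}(\Delta),s,t)=\sum_{p,q}\dim_{\mathbf{K}}(\overline{R^p_q})\,s^pt^q .$$ Let $\mathcal{A}(\Delta)=\{\ker\alpha\mid\alpha\in\Delta\}$, a central hyperplane arrangement in $V$. Let $L=L(\Delta)$ be the set of all intersections of (possibly empty) subfamilies of $\mathcal{A}(\Delta)$ (the empty intersection being $V$), partially ordered by reverse inclusion: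 $X\le Y\iff X\supseteq Y$. The Möbius function $\mu:L\to\mathbb{Z}$ is characterized by $\mu(V)=1$ and $\sum_{Y\le X}\mu(Y)=0$ for every $X\in L$ with $X\neq V$ (i.e. $V<X$). The Poincaré polynomial of $\mathcal{A}(\Delta)$ is $$\mathrm{Poin}(\mathcal{A}(\Delta),t)=\sum_{X\in L}\mu(X)(-t)^{\operatorname{codim}X}.$$ *)

(* Defs.v *)
From HB Require Import structures.
From mathcomp Require Import all_boot all_order all_algebra.
From mathcomp Require Import finmap boolp mpoly.

Set Implicit Arguments.
Unset Strict Implicit.
Unset Printing Implicit Defensive.

Import Order.TTheory GRing.Theory Num.Theory.
Local Open Scope ring_scope.

Record fps (R : Type) : Type := FPS { fcoef :> nat -> R }.

HB.instance Definition _ (R : Type) := gen_eqMixin (fps R).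
HB.instance Definition _ (R : Type) := gen_choiceMixin (fps R).

Lemma fpsP (R : Type) (f g : fps R) : f =1 g -> f = g.
Proof. by case: f g => f [g] /= fg; congr FPS; apply/funext. Qed.

Section FpsRing.
Variable R : comNzRingType.
Implicit Types f g h : fps R.

Definition fps_zero : fps R := FPS (fun=> 0).
Definition fps_opp f : fps R := FPS (fun n => - f n).
Definition fps_add f g : fps R := FPS (fun n => f n + g n).
Definition fpsC (c : R) : fps R := FPS (fun n => if n is 0%N then c else 0).
Definition fpsX : fps R := FPS (fun n => (n == 1%N)%:R).
Definition fps_mul f g : fps R := FPS (fun n => \sum_(i < n.+1) f i * g (n - i)%N).

Lemma fps_addA : associative fps_add.
Proof. by move=> f g h; apply: fpsP => n /=; rewrite addrA. Qed.
Lemma fps_addC : commutative fps_add.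
Proof. by move=> f g; apply: fpsP => n /=; rewrite addrC. Qed.
Lemma fps_add0 : left_id fps_zero fps_add.
Proof. by move=> f; apply: fpsP => n /=; rewrite add0r. Qed.
Lemma fps_addN : left_inverse fps_zero fps_opp fps_add.
Proof. by move=> f; apply: fpsP => n /=; rewrite addNr. Qed.

HB.instance Definition _ :=
  GRing.isZmodule.Build (fps R) fps_addA fps_addC fps_add0 fps_addN.

Let trunc n f : {poly R} := \poly_(i < n.+1) f i.

Let truncE n f i : (i <= n)%N -> (trunc n f)`_i = f i.
Proof. by move=> lein; rewrite coef_poly ltnS lein. Qed.

Let mulE n f g i : (i <= n)%N -> fps_mul f g i = (trunc n f * trunc n g)`_i.
Proof.
move=> lein; rewrite coefM /=; apply: eq_bigr => j _.
have leji : (j <= i)%N by rewrite -ltnS.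
by rewrite !truncE ?(leq_trans (leq_subr _ _)) ?(leq_trans leji).
Qed.

Lemma fps_mulA : associative fps_mul.
Proof.
move=> f g h; apply: fpsP => n.
have -> : fps_mul f (fps_mul g h) n = (trunc n f * (trunc n g * trunc n h))`_n.
  rewrite coefM; apply: eq_bigr => i _.
  by rewrite truncE -1?ltnS // -(mulE g h (leq_subr i n)).
rewrite mulrA [RHS]/= coefM; apply: eq_bigr => i _.
have lein : (i <= n)%N by rewrite -ltnS.
by rewrite truncE ?leq_subr // -(mulE f g lein).
Qed.

Lemma fps_mulC : commutative fps_mul.
Proof. by move=> f g; apply: fpsP => n; rewrite !(mulE _ _ (leqnn n)) mulrC. Qed.

Lemma fps_mul1 : left_id (fpsC 1) fps_mul.
Proof.
move=> f; apply: fpsP => n /=.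
by rewrite big_ord_recl subn0 mul1r big1 ?addr0 // => i _; rewrite mul0r.
Qed.

Lemma fps_mulD : left_distributive fps_mul fps_add.
Proof.
move=> f g h; apply: fpsP => n /=.
by rewrite -big_split; apply: eq_bigr => i _; rewrite mulrDl.
Qed.

Lemma fps_oner_neq0 : fpsC 1 != 0.
Proof.
by apply/eqP => /(congr1 (fun f : fps R => f 0%N)) /= /eqP; rewrite oner_eq0.
Qed.

HB.instance Definition _ := GRing.Zmodule_isComNzRing.Build (fps R)
  fps_mulA fps_mulC fps_mul1 fps_mulD fps_oner_neq0.

(* As for any comUnitRingType, the inverse of a non-unit is itself. *)
Definition fps_unit : pred (fps R) := fun f => `[< exists g, g * f = 1 >].
Definition fps_inv f : fps R :=
  if pselect (exists g, g * f = 1) is left h then projT1 (cid h) else f.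

Lemma fps_mulVr : {in fps_unit, left_inverse 1 fps_inv *%R}.
Proof.
move=> f /asboolP uf; rewrite /fps_inv; case: pselect => // h.
by case: (cid h).
Qed.
Lemma fps_unitP f g : g * f = 1 -> fps_unit f.
Proof. by move=> gf; apply/asboolP; exists g. Qed.
Lemma fps_inv_out : {in [predC fps_unit], fps_inv =1 id}.
Proof.
by move=> f /asboolP nuf; rewrite /fps_inv; case: pselect.
Qed.

HB.instance Definition _ := GRing.ComNzRing_hasMulInverse.Build (fps R)
  fps_mulVr fps_unitP fps_inv_out.

Lemma fpsC_is_zmod_morphism : zmod_morphism fpsC.
Proof. by move=> a b; apply: fpsP => -[|n] //=; rewrite subr0. Qed.
Lemma fpsC_is_monoid_morphism : monoid_morphism fpsC.
Proof.
split=> // a b; apply: fpsP => n /=; rewrite big_ord_recl /= subn0.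
rewrite [X in _ + X]big1 ?addr0 => [|i _]; last by rewrite mul0r.
by case: n => //= n; rewrite mulr0.
Qed.
HB.instance Definition _ := GRing.isZmodMorphism.Build R (fps R) fpsC
  fpsC_is_zmod_morphism.
HB.instance Definition _ := GRing.isMonoidMorphism.Build R (fps R) fpsC
  fpsC_is_monoid_morphism.

Lemma fps_geomE : FPS (fun=> 1) * (1 - fpsX) = 1.
Proof.
apply: fpsP => n; rewrite /= (eq_bigr (fun i : 'I_n.+1 =>
  (fpsC 1 (n - i)%N - (n - i == 1)%N%:R))); last by move=> i _; rewrite mul1r.
rewrite big_ord_recr /= subnn /= subr0; case: n => [|n]; first by rewrite big_ord0 add0r.
rewrite big_ord_recr /= subSnn /= sub0r big1 ?add0r ?addNr // => i _.
have : (1 < n.+1 - i)%N by rewrite ltn_subRL addn1 ltnS ltn_ord.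
by case: (n.+1 - i)%N => [|[|m]] //= _; rewrite subrr.
Qed.

Lemma fps_unit_subX : 1 - fpsX \is a GRing.unit.
Proof. exact: fps_unitP fps_geomE. Qed.

End FpsRing.

(* [fps2] is Z[[s]][[t]]: the coefficient of s^p t^q in F is [F q p]. *)
Notation fps2 := (fps (fps int)).
Definition ps_s : fps2 := fpsC (fpsX int).
Definition ps_t : fps2 := fpsX (fps int).

Lemma unit_sub_s : 1 - ps_s \is a GRing.unit.
Proof.
by rewrite -(rmorph1 (@fpsC (fps int))) -rmorphB rmorph_unit ?fps_unit_subX.
Qed.

Lemma unit_sub_t : 1 - ps_t \is a GRing.unit.
Proof. exact: fps_unit_subX. Qed.

(* Subspaces of a possibly infinite-dimensional vector space are encoded as
   predicates. *)

Section Subspaces.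
Variables (K : fieldType) (E : lmodType K).
Implicit Types P U W : E -> Prop.

Definition kspan P (v : E) : Prop :=
  exists n (c : 'I_n -> K) (x : 'I_n -> E),
    (forall i, P (x i)) /\ v = \sum_(i < n) c i *: x i.

Definition sub_add U W (v : E) : Prop :=
  exists u w, [/\ U u, W w & v = u + w].

(* The classes of b_0, ..., b_(n-1) form a basis of U / W. *)
Definition quot_basis U W n (b : 'I_n -> E) : Prop :=
  [/\ forall i, U (b i),
      forall u, U u -> exists c : 'I_n -> K, W (u - \sum_(i < n) c i *: b i)
    & forall c : 'I_n -> K, W (\sum_(i < n) c i *: b i) -> forall i, c i = 0].

Definition quot_has_dim U W n : Prop := exists b : 'I_n -> E, quot_basis U W b.

Definition quot_findim U W : Prop := exists n, quot_has_dim U W n.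

(* dim_K (U / W); the value is 0 by convention if U / W has infinite
   dimension, so it is to be used together with [quot_findim]. *)
Definition quot_dim U W : nat :=
  if pselect (quot_findim U W) is left h then projT1 (cid h) else 0%N.

Lemma quot_has_dim_uniq U W m n :
    W 0 -> (forall c u v, W u -> W v -> W (c *: u + v)) ->
  quot_has_dim U W m -> quot_has_dim U W n -> m = n.
Proof.
move=> W0 Wlin.
suff le m' n' : quot_has_dim U W m' -> quot_has_dim U W n' -> (m' <= n')%N.
  by move=> hm hn; apply/eqP; rewrite eqn_leq !le.
move=> [b [Ub _ bfree]] [b' [_ gen _]]; rewrite leqNgt; apply/negP => lt_nm.
have [c cE] := choice (fun i => gen _ (Ub i)).
pose M := \matrix_(i < m', j < n') c i j.
have kerN0 : kermx M != 0.
  rewrite -mxrank_eq0 mxrank_ker subn_eq0 -ltnNge.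
  exact: leq_ltn_trans (rank_leq_col M) lt_nm.
have [i /rowP rN0] : exists i, row i (kermx M) <> 0.
  apply: contrapT => /forallNP r0; case/eqP: kerN0; apply/row_matrixP => i.
  by rewrite row0; apply: contrapT; exact: r0.
apply: rN0 => j; rewrite mxE [RHS]mxE.
set k := row i (kermx M).
have kM : k *m M = 0 by rewrite -row_mul mulmx_ker row0.
suff : W (\sum_(j < m') k 0 j *: b j) by move=> /bfree /(_ j); rewrite mxE.
have -> : \sum_(j < m') k 0 j *: b j =
          \sum_(j < m') k 0 j *: (b j - \sum_(l < n') c j l *: b' l).
  rewrite [RHS](eq_bigr (fun j => k 0 j *: b j -
    \sum_(l < n') (k 0 j * c j l) *: b' l)) => [|i' _]; last first.
    rewrite scalerBr scaler_sumr (eq_bigr (fun l => (k 0 i' * c i' l) *: b' l)) //.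
    by move=> l _; rewrite scalerA.
  rewrite sumrB [X in _ = _ - X]exchange_big.
  rewrite [X in _ = _ - X]big1 ?subr0 // => l _.
  rewrite -scaler_suml (_ : \sum_(j' < m') _ = (k *m M) 0 l).
    by rewrite kM mxE scale0r.
  by rewrite [RHS]mxE; apply: eq_bigr => j' _; congr (_ * _); rewrite mxE.
elim: (index_enum _) => [|a r IHr]; first by rewrite big_nil.
by rewrite big_cons; apply: Wlin.
Qed.

Lemma quot_dim_eq U W n :
    W 0 -> (forall c u v, W u -> W v -> W (c *: u + v)) ->
  quot_has_dim U W n -> quot_dim U W = n.
Proof.
move=> W0 Wlin hn; rewrite /quot_dim; case: pselect => [h|[]]; last by exists n.
by case: (cid h) => m hm /=; apply: quot_has_dim_uniq hm hn.
Qed.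

Lemma quot_dim_triv U W : (forall u, U u -> u = 0) -> W 0 -> quot_dim U W = 0%N.
Proof.
move=> U0 W0; rewrite /quot_dim; case: pselect => // h.
case: (cid h) => -[//|n] [b [Ub _ bfree]] /=.
have /bfree/(_ ord0)/eqP : W (\sum_(i < n.+1) (fun=> 1 : K) i *: b i).
  by rewrite big1 // => i _; rewrite (U0 _ (Ub i)) scaler0.
by rewrite oner_eq0.
Qed.

End Subspaces.

Section RationalFunctions.
Variables (K : fieldType) (V : vectType K).

(* S(V^* ), the variable 'X_i being the i-th coordinate form with respect to
   the basis [vbasis {:V}] of V. *)
Definition polfun := {mpoly K[\dim {:V}]}.

Definition linform (a : 'Hom(V, K^o)) : polfun :=
  \sum_(i < \dim {:V}) a (vbasis {:V})`_i *: 'X_i.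

Lemma linformE (a : 'Hom(V, K^o)) (v : V) :
  (linform a).@[fun i => coord (vbasis {:V}) i v] = a v.
Proof.
rewrite [in RHS](coord_vbasis (memvf v)) linear_sum raddf_sum /=.
by apply: eq_bigr => i _; rewrite mevalZ mevalXU linearZ /= mulrC.
Qed.

(* With this convention deg 0 = 0, which is harmless here: the zero polynomial
   is only compared with bounds p >= 0. *)
Definition deg (f : polfun) : nat := (msize f).-1.

Definition ratfun := {fraction polfun}.

HB.instance Definition _ := GRing.Field.on ratfun.

Definition rat_of (f : polfun) : ratfun := tofrac f.

Definition ratfun_scale (c : K) (x : ratfun) : ratfun := rat_of c%:MP * x.

Lemma ratfun_scaleA a b v :
  ratfun_scale a (ratfun_scale b v) = ratfun_scale (a * b) v.
Proof. by rewrite /ratfun_scale mulrA /rat_of mpolyCM rmorphM. Qed.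
Lemma ratfun_scale1 : left_id 1 ratfun_scale.
Proof. by move=> v; rewrite /ratfun_scale /rat_of mpolyC1 rmorph1 mul1r. Qed.
Lemma ratfun_scaleDr : right_distributive ratfun_scale +%R.
Proof. by move=> a u v; rewrite /ratfun_scale mulrDr. Qed.
Lemma ratfun_scaleDl v : {morph ratfun_scale^~ v : a b / a + b}.
Proof. by move=> a b; rewrite /ratfun_scale /rat_of mpolyCD rmorphD mulrDl. Qed.

HB.instance Definition _ := GRing.Zmodule_isLmodule.Build K ratfun
  ratfun_scaleA ratfun_scale1 ratfun_scaleDr ratfun_scaleDl.

Variable Delta : {fset 'Hom(V, K^o)}.

(* R(Delta) = S[Delta^-1], the subalgebra of the field of rational functions
   generated by S and the inverses of the elements of Delta. *)
Inductive inR : ratfun -> Prop :=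
  | inR_pol f : inR (rat_of f)
  | inR_inv a : a \in Delta -> inR (rat_of (linform a))^-1
  | inR_add x y : inR x -> inR y -> inR (x + y)
  | inR_mul x y : inR x -> inR y -> inR (x * y).

Definition Rfil (p q : int) : ratfun -> Prop :=
  match p, q with
  | Posz p', Posz q' =>
      kspan (fun x => inR x /\ exists f g : polfun,
        [/\ g != 0, x = rat_of f / rat_of g, (deg f <= p')%N & (deg g <= q')%N])
  | _, _ => fun x => x = 0
  end.

Definition Rfil_lower (p q : int) : ratfun -> Prop :=
  sub_add (Rfil (p - 1) q) (Rfil p (q - 1)).

Definition Rbar_findim (p q : int) : Prop :=
  quot_findim (Rfil p q) (Rfil_lower p q).

Definition Rbar_dim (p q : int) : nat :=
  quot_dim (Rfil p q) (Rfil_lower p q).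

Lemma Rfil0 p q : Rfil p q 0.
Proof.
case: p q => [p|p] [q|q] //=.
by exists 0%N, (fun=> 0), (fun=> 0); split=> [[]//|]; rewrite big_ord0.
Qed.

Lemma Rbar_dim_neg (p q : int) : (p < 0) || (q < 0) -> Rbar_dim p q = 0%N.
Proof.
move=> pq; apply: quot_dim_triv; last first.
  by exists 0, 0; split; [exact: Rfil0 | exact: Rfil0 | rewrite addr0].
by case: p q pq => [p|p] [q|q].
Qed.

(* By [Rbar_dim_neg], only nonnegative p and q contribute. *)
Definition poin_Rbar : fps2 :=
  FPS (fun q => FPS (fun p => (Rbar_dim (Posz p) (Posz q))%:Z)).

End RationalFunctions.

Section Arrangement.
Variables (K : fieldType) (V : vectType K) (Delta : {fset 'Hom(V, K^o)}).
Implicit Types X Y : {vspace V}.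

Definition arr : {fset {vspace V}} := [fset lker a | a in Delta]%fset.

Definition arrL : {fset {vspace V}} :=
  [fset (\bigcap_(H <- enum_fset B) H)%VS
     | B : {fset {vspace V}} in fpowerset arr]%fset.

Definition codim X : nat := (\dim {:V} - \dim X)%N.

(* The order is reverse inclusion: Y <= X in L means (X <= Y)%VS. *)
Fixpoint mobius_rec n X : int :=
  if n is n'.+1 then
    if X == fullv then 1
    else - \sum_(Y <- enum_fset arrL | (X <= Y)%VS && (Y != X)) mobius_rec n' Y
  else 0.

(* Elements below X in L have smaller codimension, so (codim X).+1 levels of
   recursion suffice. *)
Definition mobius X : int := mobius_rec (codim X).+1 X.

Lemma codim_lt X Y : (X <= Y)%VS -> Y != X -> (codim Y < codim X)%N.
Proof.
move=> XY YX; have lt : (\dim X < \dim Y)%N.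
  rewrite ltn_neqAle dimvS // andbT; apply: contra YX => dXY.
  by rewrite eq_sym eqEdim XY (eqP dXY) leqnn.
by rewrite /codim ltn_sub2l // (leq_trans lt) // dimvS // subvf.
Qed.

Lemma mobius_recE m n X :
  (codim X < m)%N -> (codim X < n)%N -> mobius_rec m X = mobius_rec n X.
Proof.
elim: m n X => [//|m IHm] [//|n] X ltm ltn /=; case: eqP => // _.
congr (- _); apply: eq_bigr => Y /andP[XY YX].
have ltY := codim_lt XY YX.
by apply: IHm; [exact: leq_trans ltY ltm | exact: leq_trans ltY ltn].
Qed.

Lemma mobius_fullv : mobius fullv = 1.
Proof. by rewrite /mobius /= eqxx. Qed.

Lemma mobius_sum X : X \in arrL -> X != fullv ->
  \sum_(Y <- enum_fset arrL | (X <= Y)%VS) mobius Y = 0.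
Proof.
move=> XL XV; rewrite -big_filter (bigD1_seq X) /=; last 2 first.
- by rewrite mem_filter subvv XL.
- by rewrite filter_uniq ?fset_uniq.
rewrite big_filter_cond {1}/mobius /= (negPf XV).
rewrite (eq_bigr mobius) ?addNr // => Y /andP[XY YX].
exact: mobius_recE (codim_lt XY YX) (ltnSn _).
Qed.

Definition poin_arr : {poly int} :=
  \sum_(X <- enum_fset arrL) mobius X *: (- 'X) ^+ codim X.

End Arrangement.

(* Main.v *)
Require Import Defs.
From HB Require Import structures.
From mathcomp Require Import all_boot all_order all_algebra.
From mathcomp Require Import finmap boolp mpoly.
From mathcomp Require Import zify.

Set Implicit Arguments.
Unset Strict Implicit.
Unset Printing Implicit Defensive.

Import Order.TTheory GRing.Theory Num.Theory.
Local Open Scope ring_scope.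

(** Number the forms of [Delta] as [al i]. A set of forms is nbc if it contains no
    broken circuit, that is, no circuit with its first element removed. Both sides
    of the formula are computed as sums over the nbc sets [B], which are linearly
    independent.

    For the arrangement this is Whitney's theorem [poin_arr_nbc]: the Möbius
    function at a flat is the sum of [(-1) ^+ #|B|] over all sets [B] of forms with
    this flat as common kernel, and a sign-reversing involution cancels the sets
    that contain a broken circuit. So the Poincaré polynomial is the sum of
    [t ^ #|B|] over the nbc sets.

    For the algebra, choose for each nbc set [B] a set [coords B] of
    [l - #|B|] variables that are coordinates modulo the span of [B]. The fractions
    whose denominator is a product of powers of forms with support exactly an nbc
    set [B], and whose numerator is a monomial in the variables of [coords B], form
    a basis of R(Delta) over K adapted to the bifiltration: those with numerator
    of degree at most p and denominator of degree at most q form a basis of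
    R^p_q ([RfilP]). They span by [straighten]: a linear relation that exhibits a
    broken circuit lets one replace a factor of the denominator by an earlier form,
    and numerators are reduced modulo the forms of the denominator. That only
    denominators made of linear forms of degree at most q are needed is because
    linear forms are prime ([frac_cancel]). They are independent by
    [lin_indep_nbc]: going through the forms from last to first, the coefficient of
    the pole of highest order along a form gives, after restriction to its kernel,
    a shorter relation.

    Hence the piece of bidegree (p, q) has as basis the fractions with numerator of
    degree p and denominator of degree q. The exponents of the denominator are
    positive integers on [B] and those of the numerator arbitrary on [coords B], so
    that the series is the sum over [B] of (t / (1 - t)) ^ #|B| divided by
    (1 - s) ^ (l - #|B|), which is the right-hand side. *)

(** * No broken circuit sets and the Poincaré polynomial *)

Lemma sum_involution0 (M : zmodType) (T : finType) (P : pred T) (h : T -> T)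
    (f : T -> M) :
    (forall y : M, y = - y -> y = 0) ->
    (forall x, P x -> [/\ P (h x), h (h x) = x & f (h x) = - f x]) ->
  \sum_(x | P x) f x = 0.
Proof.
move=> M2 hP; apply: M2.
rewrite {1}(reindex_onto h h) /= => [|x /hP[]//]; rewrite -sumrN.
apply: eq_big => [x|x /andP[Phx /eqP hhx]].
  apply/andP/idP => [[/hP[Phhx _ _] /eqP hhx]|/hP[-> -> _]//].
  by rewrite -hhx.
by have [_ _] := hP _ Phx; rewrite hhx => ->; rewrite opprK.
Qed.

Section Whitney.
Variables (K : fieldType) (V : vectType K) (n : nat) (al : 'I_n -> 'Hom(V, K^o)).
Implicit Types (B C : {set 'I_n}) (i j : 'I_n) (X Y : {vspace V}).

Definition flat B : {vspace V} := (\bigcap_(i in B) lker (al i))%VS.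

(** Linear dependence of [al i] on the forms of [B], phrased with kernels so that
    it can be read off the intersection lattice; [depE] gives the span version. *)
Definition dep i B : bool := (flat B <= lker (al i))%VS.

Definition above i : {set 'I_n} := [set j : 'I_n | (i < j)%N].

(** A circuit with its first element [i] removed is a set of later indices on
    which [i] depends; hence no broken circuit inside [B] means no [i] depending
    on the part of [B] after it. *)
Definition nbc B : bool := [forall i, ~~ dep i (B :&: above i)].

Lemma flatP X B :
  reflect (forall i, i \in B -> (X <= lker (al i))%VS) (X <= flat B)%VS.
Proof. exact: subv_bigcapP. Qed.

Lemma flatS B C : B \subset C -> (flat C <= flat B)%VS.
Proof.
by move=> BC; apply/flatP => i iB; apply: bigcapv_inf (subvv _); apply: (subsetP BC).
Qed.

Lemma flat0 : flat set0 = fullv.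
Proof. by rewrite /flat big_set0. Qed.

Lemma flatU1 i B : flat (i |: B) = (flat B :&: lker (al i))%VS.
Proof.
apply: subv_anti; apply/andP; split.
  rewrite subv_cap flatS ?subsetUr //=.
  by apply: bigcapv_inf (subvv _); rewrite setU11.
apply/flatP => j; rewrite !inE => /orP[/eqP->|jB]; first exact: capvSr.
by apply: subv_trans (capvSl _ _) _; apply: bigcapv_inf (subvv _).
Qed.

Lemma depS i B C : B \subset C -> dep i B -> dep i C.
Proof. by move=> BC; apply: subv_trans (flatS BC). Qed.

Lemma nbcS B C : B \subset C -> nbc C -> nbc B.
Proof.
move=> BC /forallP nC; apply/forallP => i; apply: contra (nC i).
exact/depS/setSI.
Qed.

(** An nbc set is built by adjoining its elements from the last to the first, each
    one independent of those already present. *)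
Lemma nbc_ind (P : {set 'I_n} -> Prop) :
    P set0 ->
    (forall i B, i \notin B -> nbc B -> ~~ dep i B -> P B -> P (i |: B)) ->
  forall B, nbc B -> P B.
Proof.
move=> P0 PU B; move: {2}(#|B|) (leqnn #|B|) => m.
elim: m B => [|m IHm] B.
  by rewrite leqn0 cards_eq0 => /eqP->.
have [->//|/set0Pn[i0 i0B] leBm nB] := eqVneq B set0.
case: (@arg_minnP _ i0 (fun i => i \in B) (fun i : 'I_n => i : nat) i0B) => i /= iB imin.
rewrite -(setD1K iB).
have DB : B :&: above i = B :\ i.
  apply/setP => j; rewrite !inE andbC; case jB: (j \in B); last by rewrite !andbF.
  by rewrite !andbT ltn_neqAle imin // andbT eq_sym.
have nD : nbc (B :\ i) by apply: nbcS nB; apply: subD1set.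
apply: PU => //; first by rewrite !inE eqxx.
  by rewrite -DB; apply: (forallP nB).
by apply: IHm => //; move: leBm; rewrite (cardsD1 i) iB.
Qed.

Lemma dim_cap_lker X (a : 'Hom(V, K^o)) :
  ~~ (X <= lker a)%VS -> (\dim (X :&: lker a)).+1 = \dim X.
Proof.
move=> Xa; rewrite -(limg_ker_dim a X) -[LHS]addn1; congr (_ + _)%N.
have le1 : (\dim (a @: X) <= 1)%N.
  by apply: leq_trans (dimvS (subvf _)) _; rewrite dimvf.
suff : (0 < \dim (a @: X))%N by case: (\dim _) le1 => [|[]].
rewrite lt0n dimv_eq0; apply: contra Xa => /eqP aX0.
by rewrite lkerE aX0.
Qed.

Lemma codim_flat_nbc B : nbc B -> codim (flat B) = #|B|.
Proof.
elim/nbc_ind => [|i {}B iB nB idep IH].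
  by rewrite flat0 /codim subnn cards0.
have := dim_cap_lker idep; rewrite -flatU1 => dimE.
rewrite cardsU1 iB add1n -IH /codim -dimE subnSK //.
by rewrite dimE; apply: dimvS (subvf _).
Qed.

Definition toggle i B := if i \in B then B :\ i else i |: B.

Lemma toggleK i : involutive (toggle i).
Proof.
move=> B; have [iB|iB] := boolP (i \in B); rewrite /toggle ?iB ?(negPf iB).
  by rewrite setD11 setD1K.
by rewrite setU11 setU1K.
Qed.

Lemma in_toggle i j B : i != j -> (j \in toggle i B) = (j \in B).
Proof. by rewrite eq_sym /toggle => /negPf ij; case: ifP => _; rewrite !inE ij. Qed.

Lemma sign_toggle (R : nzRingType) i B :
  (-1) ^+ #|toggle i B| = - (-1) ^+ #|B| :> R.
Proof.
rewrite /toggle; case: ifP => iB; last by rewrite cardsU1 iB exprS mulN1r.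
by rewrite (cardsD1 i B) iB exprS mulN1r opprK.
Qed.

Lemma flat_toggle i B C :
  C \subset B :\ i -> dep i C -> flat (toggle i B) = flat B.
Proof.
move=> CB iC.
have flatE (A : {set _}) : C \subset A -> flat (i |: A) = flat A.
  by move=> CA; rewrite flatU1; apply/capv_idPl/(depS CA iC).
rewrite /toggle; case: ifPn => iB; last by rewrite flatE // (subset_trans CB) ?subD1set.
by rewrite -[in RHS](setD1K iB) flatE.
Qed.

(** Let [i] be the last index that depends on the part of [B] after it. Toggling
    [i] in [B] preserves the flat and reverses the sign, and changes nothing
    strictly after [i], so that [i] is again the last such index. This involution
    cancels all sets that contain a broken circuit. *)
Lemma whitney_nbc (M : lmodType int) (g : {vspace V} -> M) :
    (forall y : M, y = - y -> y = 0) ->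
  \sum_(B : {set 'I_n}) (-1) ^+ #|B| *: g (flat B) =
  \sum_(B : {set 'I_n} | nbc B) (-1) ^+ #|B| *: g (flat B).
Proof.
move=> M2; rewrite [LHS](bigID nbc) /= [X in _ + X](_ : _ = 0) ?addr0 //.
pose bad i (B : {set 'I_n}) := dep i (B :&: above i).
pose last i (B : {set 'I_n}) := bad i B && [forall j : 'I_n, (i < j)%N ==> ~~ bad j B].
have badP (B : {set 'I_n}) : ~~ nbc B -> exists i, last i B.
  case/forallPn => i0; rewrite negbK => bi0.
  case: (@arg_maxnP _ i0 (bad^~ B) (fun i : 'I_n => i : nat) bi0) => i bi imax.
  exists i; rewrite /last bi; apply/forallP => j; apply/implyP.
  by rewrite ltnNge; apply: contra => /imax.
have badT i j B : (i <= j)%N -> bad j (toggle i B) = bad j B.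
  move=> ij; congr dep; apply/setP => k; rewrite !inE.
  case jk: (j < k)%N; rewrite ?andbF // !andbT in_toggle //.
  by rewrite -val_eqE /= neq_ltn (leq_ltn_trans ij jk).
have lastT i B : last i (toggle i B) = last i B.
  rewrite /last badT //; congr (_ && _); apply: eq_forallb => j.
  by case ij: (i < j)%N => //=; rewrite badT // ltnW.
have lastU i j B : last i B -> last j B -> i = j.
  case/andP=> bi /forallP/(_ j) li /andP[bj /forallP/(_ i) lj]; apply: ord_inj.
  by move: li lj; rewrite bi bj; case: ltngtP.
pose h (B : {set 'I_n}) := if [pick i | last i B] is Some i then toggle i B else B.
have hE i B : last i B -> h B = toggle i B.
  move=> li; rewrite /h; case: pickP => [j lj|/(_ i)]; last by rewrite li.
  by rewrite (lastU _ _ _ lj li).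
apply: (@sum_involution0 _ _ _ h) => // B /badP[i li].
have liT : last i (toggle i B) by rewrite lastT.
rewrite (hE _ _ li) (hE _ _ liT) toggleK; split=> //.
  by apply/forallPn; exists i; rewrite negbK; case/andP: liT.
rewrite sign_toggle scaleNr (@flat_toggle i B (B :&: above i)) //.
  by apply/subsetP => j; rewrite !inE => /andP[-> ij]; rewrite -val_eqE /= gtn_eqF.
by case/andP: li.
Qed.

End Whitney.

Section Moebius.
Variables (K : fieldType) (V : vectType K) (Delta : {fset 'Hom(V, K^o)}).
Variables (n : nat) (al : 'I_n -> 'Hom(V, K^o)).
Hypothesis alP : forall a, a \in Delta <-> exists i, al i = a.
Hypothesis al_neq0 : forall i, al i != 0.
Implicit Types (B C : {set 'I_n}) (i j : 'I_n) (X Y : {vspace V}).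

Lemma subv_bigcap_seqP (s : seq {vspace V}) X :
  reflect (forall H, H \in s -> (X <= H)%VS) (X <= \bigcap_(H <- s) H)%VS.
Proof.
elim: s => [|H s IHs]; first by rewrite big_nil subvf; apply: (iffP idP).
rewrite big_cons subv_cap; apply: (iffP andP) => [[XH /IHs Xs] H'|Xs].
  by rewrite inE => /predU1P[->|/Xs].
split; first by apply: Xs; rewrite mem_head.
by apply/IHs => H' sH'; apply: Xs; rewrite inE sH' orbT.
Qed.

Lemma arrLP X : reflect (exists B, X = flat al B) (X \in arrL Delta).
Proof.
rewrite /arrL; apply: (iffP (imfsetP _ _ _ _)) => [[A /=]|[B ->]].
  rewrite fpowersetE => /fsubsetP Aarr ->.
  exists [set i | lker (al i) \in A]; apply: subv_anti; apply/andP; split.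
    apply/flatP => i; rewrite inE => iA.
    exact: (subv_bigcap_seqP _ _ (subvv _)).
  apply/subv_bigcap_seqP => H HA.
  have /imfsetP[a /= /alP[i <-] HE] := Aarr _ HA; rewrite HE.
  by apply: (flatP _ _ _ (subvv _)); rewrite inE -HE.
exists [fset lker (al i) | i in B]%fset => /=.
  rewrite fpowersetE; apply/fsubsetP => H /imfsetP[i /= iB ->]; apply/imfsetP.
  by exists (al i) => //=; apply/alP; exists i.
apply: subv_anti; apply/andP; split.
  apply/subv_bigcap_seqP => H /imfsetP[i /= iB ->].
  exact: (flatP _ _ _ (subvv _)).
apply/flatP => i iB; apply: (subv_bigcap_seqP _ _ (subvv _)).
by apply/imfsetP; exists i.
Qed.

Lemma flat_arrL B : flat al B \in arrL Delta.
Proof. by apply/arrLP; exists B. Qed.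

Lemma sum_arrL_flat (M : nmodType) (P : pred {vspace V}) (F : {set 'I_n} -> M) :
  \sum_(Y <- enum_fset (arrL Delta) | P Y) \sum_(B | flat al B == Y) F B =
  \sum_(B | P (flat al B)) F B.
Proof.
rewrite (exchange_big_dep (fun B => P (flat al B))) /=; last first.
  by move=> Y B PY /eqP->.
apply: eq_bigr => B PB; rewrite -big_filter.
rewrite (_ : [seq _ <- _ | _] = [:: flat al B]) ?big_seq1 //.
rewrite (eq_filter (a2 := pred1 (flat al B))) => [|Y]; last first.
  by rewrite /= eq_sym; case: eqP => [->|_]; rewrite ?PB ?andbF.
by rewrite filter_pred1_uniq ?fset_uniq //; apply: flat_arrL.
Qed.

Lemma sum_sign_above X :
  \sum_(B | (X <= flat al B)%VS) (-1) ^+ #|B| =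
  [forall i, ~~ (X <= lker (al i))%VS]%:R :> int.
Proof.
case: (boolP [forall i, _]) => [/forallP noX|/forallPn[i0]].
  rewrite (big_pred1 set0) ?cards0 // => B.
  apply/idP/eqP => [/flatP XB|->]; last by rewrite flat0 subvf.
  apply/setP => i; rewrite inE; apply/negP => /XB.
  exact/negP.
rewrite negbK => Xi0; apply: (@sum_involution0 _ _ _ (toggle i0)).
  by move=> y; lia.
move=> B /flatP XB; split; [apply/flatP => i|exact: toggleK|exact: sign_toggle].
have [<- //|ii0] := eqVneq i0 i; by rewrite in_toggle // => /XB.
Qed.

(** The right-hand side satisfies the recursion that characterizes the Möbius
    function: summed over the flats containing [X], it is the alternating sum
    over all sets of forms vanishing on [X], and this vanishes as soon as one
    form does. *)
Lemma mobiusE X : X \in arrL Delta ->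
  mobius Delta X = \sum_(B | flat al B == X) (-1) ^+ #|B|.
Proof.
move: {2}(codim X) (leqnn (codim X)) => m.
elim/ltn_ind: m X => m IHm X leXm XL.
pose nu Y : int := \sum_(B | flat al B == Y) (-1) ^+ #|B|.
have [->|XV] := eqVneq X fullv.
  rewrite mobius_fullv.
  transitivity (\sum_(B | (fullv <= flat al B)%VS) (-1) ^+ #|B| : int).
    rewrite sum_sign_above (_ : [forall i, _]) //.
    apply/forallP => i; apply: contra (al_neq0 i) => /subvP iV.
    by apply/eqP/lfunP => v; rewrite lfunE; apply/eqP; rewrite -memv_ker iV ?memvf.
  by apply: eq_bigl => B; rewrite eqEsubv subvf.
have nu0 : \sum_(Y <- enum_fset (arrL Delta) | (X <= Y)%VS) nu Y = 0.
  rewrite sum_arrL_flat sum_sign_above; case: forallP => // noX.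
  have /arrLP[B XB] := XL; case/eqP: XV; rewrite XB.
  rewrite (_ : B = set0) ?flat0 //; apply/setP => i; rewrite inE.
  apply/negP => iB; case/negP: (noX i); rewrite XB.
  exact: (flatP _ _ _ (subvv _)).
have split1 (f : {vspace V} -> int) :
    \sum_(Y <- enum_fset (arrL Delta) | (X <= Y)%VS) f Y =
    f X + \sum_(Y <- enum_fset (arrL Delta) | (X <= Y)%VS && (Y != X)) f Y.
  rewrite -big_filter (bigD1_seq X) /=; last 2 first.
  - by rewrite mem_filter subvv XL.
  - by rewrite filter_uniq ?fset_uniq.
  by rewrite big_filter_cond.
have := mobius_sum XL XV; rewrite -[in RHS]nu0 !split1.
rewrite -/(nu X) big_seq_cond [in RHS]big_seq_cond.
rewrite (eq_bigr nu) => [/addIr //|Y /andP[YL /andP[XY YX]]].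
have ltY := codim_lt XY YX.
exact: (IHm (codim Y) (leq_trans ltY leXm)).
Qed.

Lemma poly_int_torsion (y : {poly int}) : y = - y -> y = 0.
Proof.
move=> /polyP yN; apply/polyP => k; have := yN k.
rewrite coefN coef0; move: y`_k => z; lia.
Qed.

(** Whitney's theorem: after grouping the sets of forms by their flat, the
    cancellation leaves one monomial for each nbc set, the forms of which are
    independent, so that its cardinal is the codimension of its flat. *)
Lemma poin_arr_nbc :
  poin_arr Delta = \sum_(B : {set 'I_n} | nbc al B) 'X^#|B|.
Proof.
pose g X : {poly int} := (- 'X) ^+ codim X.
transitivity (\sum_(B : {set 'I_n}) (-1) ^+ #|B| *: g (flat al B)).
  rewrite -(@sum_arrL_flat _ predT) /poin_arr big_seq [RHS]big_seq.
  apply: eq_bigr => X XL; rewrite mobiusE // scaler_suml.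
  by apply: eq_bigr => B /eqP <-.
rewrite whitney_nbc; last exact: poly_int_torsion.
apply: eq_bigr => B nB; rewrite /g codim_flat_nbc //.
by rewrite -scaleN1r exprZn scalerA -expr2 sqrr_sign scale1r.
Qed.

End Moebius.
(** * Linear forms and coordinate complements *)

Section LinearForms.
Variables (K : fieldType) (l : nat).
Implicit Types (u v : 'rV[K]_l) (j : 'I_l).

Definition lform u : {mpoly K[l]} := \sum_(j < l) u 0 j *: 'X_j.

Fact lform_is_linear : linear lform.
Proof.
move=> c u v; rewrite /lform scaler_sumr -big_split /=.
by apply: eq_bigr => j _; rewrite !mxE scalerDl scalerA.
Qed.
HB.instance Definition _ :=
  GRing.isLinear.Build K 'rV[K]_l {mpoly K[l]} _ lform lform_is_linear.

Lemma lform_delta j : lform (delta_mx 0 j) = 'X_j.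
Proof.
rewrite /lform (bigD1 j) //= big1 => [|i /negPf ij]; rewrite mxE eqxx.
  by rewrite eqxx scale1r addr0.
by rewrite ij scale0r.
Qed.

Lemma mcoeff_lform u j : (lform u)@_U_(j) = u 0 j.
Proof.
rewrite /lform raddf_sum (bigD1 j) //= big1 => [|i /negPf ij].
  by rewrite mcoeffZ mcoeffXU eqxx mulr1 addr0.
by rewrite mcoeffZ mcoeffXU ij mulr0.
Qed.

Lemma lform_eq0 u : (lform u == 0) = (u == 0).
Proof.
apply/eqP/eqP => [u0|->]; last exact: linear0.
by apply/rowP => j; rewrite -mcoeff_lform u0 mcoeff0 mxE.
Qed.

(** Linear forms are row vectors, so [subst_mx P] is the algebra endomorphism
    induced by the linear endomorphism with matrix [P]. *)
Definition subst_mx (P : 'M[K]_l) (f : {mpoly K[l]}) : {mpoly K[l]} :=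
  f \mPo [tuple lform (row j P) | j < l].

HB.instance Definition _ P := GRing.RMorphism.copy (subst_mx P)
  (comp_mpoly [tuple lform (row j P) | j < l]).
HB.instance Definition _ P := GRing.Linear.copy (subst_mx P)
  (comp_mpoly [tuple lform (row j P) | j < l]).

Lemma subst_mxX P j : subst_mx P 'X_j = lform (row j P).
Proof. by rewrite /subst_mx comp_mpolyXU -tnth_nth tnth_mktuple. Qed.

Lemma subst_mx_lform P u : subst_mx P (lform u) = lform (u *m P).
Proof.
rewrite {1}/lform linear_sum mulmx_sum_row linear_sum.
by apply: eq_bigr => j _; rewrite !linearZ /= subst_mxX.
Qed.

Lemma subst_mxC P c : subst_mx P c%:MP = c%:MP.
Proof. exact: comp_mpolyC. Qed.

Lemma rmorph_mpoly_eq (R : nzRingType) (f g : {rmorphism {mpoly K[l]} -> R}) :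
    (forall c, f c%:MP = g c%:MP) -> (forall j, f 'X_j = g 'X_j) -> f =1 g.
Proof.
move=> fgC fgX p; rewrite (mpolyE p) !rmorph_sum /=.
apply: eq_bigr => m _; rewrite -mul_mpolyC !rmorphM /= fgC; congr (_ * _).
rewrite mpolyXE_id !rmorph_prod /=; apply: eq_bigr => j _.
by rewrite !rmorphXn /= fgX.
Qed.

Lemma subst_mx_comp P Q f : subst_mx Q (subst_mx P f) = subst_mx (P *m Q) f.
Proof.
pose g : {rmorphism {mpoly K[l]} -> {mpoly K[l]}} := subst_mx Q \o subst_mx P.
apply: (rmorph_mpoly_eq (f := g)) => [c|j] /=; first by rewrite !subst_mxC.
by rewrite !subst_mxX subst_mx_lform row_mul.
Qed.

Lemma subst_mx1 f : subst_mx 1%:M f = f.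
Proof.
apply: (rmorph_mpoly_eq (g := idfun)) => [c|j] /=; first by rewrite subst_mxC.
by rewrite subst_mxX row1 lform_delta.
Qed.

(** The rows of [cokermx W] are the images of the unit vectors in the quotient
    by the row space of [W]; the coordinates whose images form a basis of this
    quotient are those that [maxrankfun] selects. *)
Section Complement.
Variables (m : nat) (W : 'M[K]_(m, l)).
Let C := cokermx W.

Definition free_coords : {set 'I_l} := [set maxrankfun C i | i : 'I_(\rank C)].

Definition proj_coords : 'M[K]_l :=
  C *m pinvmx (rowsub (maxrankfun C) C) *m rowsub (maxrankfun C) 1%:M.

Lemma card_free_coords : #|free_coords| = (l - \rank W)%N.
Proof.
by rewrite card_imset ?card_ord ?mxrank_coker //; apply: maxrankfun_inj.
Qed.

Lemma mul_proj_coords0 : W *m proj_coords = 0.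
Proof. by rewrite /proj_coords 2!mulmxA [W *m C]mulmx_coker !mul0mx. Qed.

Lemma sub_1_proj_coords : (1%:M - proj_coords <= W)%MS.
Proof.
rewrite submxE mulmxBl mul1mx -/C /proj_coords.
rewrite -(mulmxA (C *m _) _ C) mul_rowsub_mx mul1mx.
by rewrite mulmxKpV ?subrr // eq_maxrowsub.
Qed.

Lemma row_proj_coords j : j \in free_coords -> row j proj_coords = delta_mx 0 j.
Proof.
case/imsetP => i _ ->.
have -> : row (maxrankfun C i) proj_coords = row i (rowsub (maxrankfun C) proj_coords).
  by apply/rowP => k; rewrite !mxE.
rewrite /proj_coords -2!mul_rowsub_mx mulmxVp ?maxrowsub_free // mul1mx.
by apply/rowP => k; rewrite !mxE eqxx eq_sym.
Qed.

Lemma proj_coords0 i j : j \notin free_coords -> proj_coords i j = 0.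
Proof.
move=> jJ; rewrite mxE big1 // => k _; rewrite !mxE; case: eqP => [kj|]; last first.
  by rewrite mulr0.
by case/negP: jJ; apply/imsetP; exists k.
Qed.

End Complement.

End LinearForms.

(** * Spans of the forms of an arrangement *)

Section SpanForms.
Variables (K : fieldType) (V : vectType K) (n : nat) (al : 'I_n -> 'Hom(V, K^o)).
Local Notation l := (\dim {:V}).
Implicit Types (B C : {set 'I_n}) (i j : 'I_n).

Definition coef_mx : 'M[K]_(n, l) := \matrix_(i, j) al i (vbasis {:V})`_j.

Definition span_mx B : 'M[K]_(n, l) :=
  \matrix_i (if i \in B then row i coef_mx else 0).

Lemma linform_coef i : linform (al i) = lform (row i coef_mx).
Proof. by apply: eq_bigr => j _; rewrite !mxE. Qed.

Lemma span_mxP B u :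
  reflect (exists c : 'I_n -> K, u = \sum_(i in B) c i *: row i coef_mx)
          (u <= span_mx B)%MS.
Proof.
have sumE (c : 'I_n -> K) :
    \sum_i c i *: row i (span_mx B) = \sum_(i in B) c i *: row i coef_mx.
  rewrite [RHS]big_mkcond; apply: eq_bigr => i _; rewrite rowK.
  by case: ifP; rewrite ?scaler0.
apply: (iffP submxP) => [[D ->]|[c ->]].
  by exists (D 0); rewrite mulmx_sum_row sumE.
exists (\row_i c i); rewrite mulmx_sum_row -sumE.
by apply: eq_bigr => i _; rewrite !mxE.
Qed.

Lemma row_span_mx B i : i \in B -> (row i coef_mx <= span_mx B)%MS.
Proof.
by move=> iB; rewrite (_ : row i _ = row i (span_mx B)) ?row_sub // rowK iB.
Qed.

Lemma span_mx_sub B m (M : 'M[K]_(m, l)) :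
  (forall i, i \in B -> (row i coef_mx <= M)%MS) -> (span_mx B <= M)%MS.
Proof.
by move=> BM; apply/row_subP => i; rewrite rowK; case: ifP => [/BM|_] //; apply: sub0mx.
Qed.

Lemma span_mxS B C : B \subset C -> (span_mx B <= span_mx C)%MS.
Proof.
by move=> BC; apply: span_mx_sub => i iB; apply/row_span_mx/(subsetP BC).
Qed.

(** Duality between forms and their kernels: the columns of [cokermx] are the
    coordinates of vectors spanning the common kernel of the forms of [B]. *)
Lemma depE i B : dep al i B = (row i coef_mx <= span_mx B)%MS.
Proof.
apply/idP/idP => [/subvP Bi|/span_mxP[c iE]].
  rewrite submxE; apply/eqP/rowP => k; rewrite [RHS]mxE.
  set C := cokermx _.
  pose v := \sum_(j < l) C j k *: (vbasis {:V})`_j.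
  have alv i' : al i' v = (row i' coef_mx *m C) 0 k.
    rewrite mxE linear_sum; apply: eq_bigr => j _.
    by rewrite linearZ !mxE mulrC.
  suff /Bi : v \in flat al B by rewrite memv_ker alv => /eqP.
  suff: (<[v]> <= flat al B)%VS by rewrite -memvE.
  apply/flatP => j jB; rewrite -memvE memv_ker alv.
  by have := row_span_mx jB; rewrite submxE => /eqP->; rewrite mxE.
have alE v : al i v = \sum_(j in B) c j * al j v.
  have evE i' : al i' v = \sum_(j < l) coord (vbasis {:V}) j v * coef_mx i' j.
    rewrite {1}(coord_vbasis (memvf v)) linear_sum; apply: eq_bigr => j _.
    by rewrite linearZ mxE.
  rewrite evE; under [RHS]eq_bigr => j _ do rewrite evE mulr_sumr.
  rewrite exchange_big; apply: eq_bigr => k _ /=.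
  have /rowP/(_ k) := iE; rewrite mxE => ->; rewrite summxE mulr_sumr.
  by apply: eq_bigr => j _; rewrite !mxE mulrCA.
apply/subvP => v vB; rewrite memv_ker alE big1 // => j jB.
have /subvP/(_ _ vB) : (flat al B <= lker (al j))%VS by apply: (flatP _ _ _ (subvv _)).
by rewrite memv_ker => /eqP->; rewrite mulr0.
Qed.

Lemma rank_span_nbc B : nbc al B -> \rank (span_mx B) = #|B|.
Proof.
elim/nbc_ind => [|i {}B iB nB idep IH].
  rewrite cards0 (_ : span_mx _ = 0) ?mxrank0 //.
  by apply/row_matrixP => i; rewrite rowK row0 inE.
have -> : \rank (span_mx (i |: B)) = \rank (span_mx B + row i coef_mx)%MS.
  apply: eqmx_rank; apply/andP; split.
    apply: span_mx_sub => j; rewrite !inE => /orP[/eqP->|jB]; first exact: addsmxSr.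
    by apply: submx_trans (row_span_mx jB) (addsmxSl _ _).
  by rewrite addsmx_sub span_mxS ?subsetUr //= row_span_mx ?setU11.
rewrite depE in idep.
have ri0 : row i coef_mx != 0 by apply: contra idep => /eqP->; apply: sub0mx.
rewrite mxrank_disjoint_sum ?IH ?rank_rV ?ri0 ?cardsU1 ?iB 1?addnC //.
apply/eqP; rewrite -mxrank_eq0; apply: contraR idep => r0.
apply: submx_trans _ (capmxSl (span_mx B) (row i coef_mx)).
rewrite -(mxrank_leqif_sup (capmxSr _ _)).2 rank_rV ri0.
by rewrite eqn_leq lt0n r0 andbT (leq_trans (mxrankS (capmxSr _ _))) // rank_rV ri0.
Qed.

End SpanForms.
(** * Subspaces spanned by a family *)

Section Spans.
Variables (K : fieldType) (E : lmodType K).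
Implicit Types (P Q : E -> Prop) (x y : E).

Lemma kspan_in P x : P x -> kspan P x.
Proof.
move=> Px; exists 1%N, (fun=> 1), (fun=> x); split=> //.
by rewrite big_ord1 scale1r.
Qed.

Lemma kspan0 P : kspan P 0.
Proof.
by exists 0%N, (fun=> 0), (fun=> 0); split=> [[]//|]; rewrite big_ord0.
Qed.

Lemma kspanZ P c x : kspan P x -> kspan P (c *: x).
Proof.
case=> n [d [y [Py ->]]]; exists n, (fun i => c * d i), y; split=> //.
by rewrite scaler_sumr; apply: eq_bigr => i _; rewrite scalerA.
Qed.

Lemma kspanD P x y : kspan P x -> kspan P y -> kspan P (x + y).
Proof.
case=> m [c [u [Pu ->]]] [n [d [v [Pv ->]]]].
pose w (T : Type) (f : 'I_m -> T) (g : 'I_n -> T) (i : 'I_(m + n)) :=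
  match split i with inl j => f j | inr j => g j end.
exists (m + n)%N, (w _ c d), (w _ u v); split.
  by move=> i; rewrite /w; case: split.
rewrite big_split_ord /=; congr (_ + _); apply: eq_bigr => i _.
  by rewrite /w (unsplitK (inl i)).
by rewrite /w (unsplitK (inr i)).
Qed.

Lemma kspan_sum P (I : eqType) (r : seq I) (A : pred I) (F : I -> E) :
  (forall i, i \in r -> A i -> kspan P (F i)) -> kspan P (\sum_(i <- r | A i) F i).
Proof.
move=> PF; rewrite big_seq_cond.
apply: (big_ind (kspan P)) => [||i /andP[/PF]//]; first exact: kspan0.
by move=> x y; apply: kspanD.
Qed.

Lemma kspan_sub P Q x : (forall y, P y -> kspan Q y) -> kspan P x -> kspan Q x.
Proof.
move=> PQ [n [c [u [Pu ->]]]]; apply: kspan_sum => i _ _.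
exact/kspanZ/PQ.
Qed.

Variables (T : eqType) (b : T -> E).
Implicit Types (G : pred T).

Definition fam G x := exists t, G t /\ x = b t.

Definition lin_indep G := forall (r : seq T) (c : T -> K),
  uniq r -> all G r -> \sum_(t <- r) c t *: b t = 0 -> forall t, t \in r -> c t = 0.

Lemma kspan_fam_uniq G x : kspan (fam G) x ->
  exists r (c : T -> K), [/\ uniq r, all G r & x = \sum_(t <- r) c t *: b t].
Proof.
case=> n [c [u [Gu ->]]]; have [t tP] := choice Gu.
pose r := undup [seq t i | i : 'I_n].
exists r, (fun t0 => \sum_(i | t i == t0) c i); split; first exact: undup_uniq.
  by apply/allP => t0; rewrite mem_undup => /mapP[i _ ->]; case: (tP i).
under [RHS]eq_bigr => t0 _ do rewrite scaler_suml.
rewrite (exchange_big_dep predT) //=; apply: eq_bigr => i _.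
rewrite -big_filter (eq_filter (a2 := pred1 (t i))) => [|t0]; last by rewrite /= eq_sym.
rewrite filter_pred1_uniq ?undup_uniq ?big_seq1 //; first by case: (tP i) => _ <-.
by rewrite mem_undup map_f ?mem_enum.
Qed.

(** When a basis of the larger space contains one of the smaller space, the
    quotient has the remaining elements as a basis. *)
Lemma quot_has_dim_fam (U W : E -> Prop) (G1 G2 : pred T) (s : seq T) :
    lin_indep G1 -> subpred G2 G1 -> uniq s ->
    (forall t, (t \in s) = G1 t && ~~ G2 t) ->
    (forall x, U x <-> kspan (fam G1) x) ->
    (forall x, W x <-> kspan (fam G2) x) ->
  quot_has_dim U W (size s).
Proof.
move=> indG sub12 us sP UP WP.
have [[t1 _]|s0] := pselect (exists t, t \in s); last first.
  have {}s0 : s = [::].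
    by case: s s0 {us sP} => // t s []; exists t; rewrite mem_head.
  rewrite s0; exists (fun=> 0); split=> [[]//|u Uu|c _ []//].
  exists (fun=> 0); rewrite big_ord0 subr0; apply/WP; move/UP: Uu.
  apply: kspan_sub => y [t [Gt ->]]; apply: kspan_in; exists t; split=> //.
  by apply: contraT => G2t; have := sP t; rewrite s0 Gt G2t.
pose bs (i : 'I_(size s)) := b (nth t1 s i).
have bsE (c : T -> K) :
    \sum_(i < size s) c (nth t1 s i) *: bs i = \sum_(t <- s) c t *: b t.
  by rewrite (big_nth t1) big_mkord.
exists bs; split.
- move=> i; apply/UP/kspan_in; exists (nth t1 s i); split=> //.
  by have := mem_nth t1 (ltn_ord i); rewrite sP => /andP[].
- move=> u /UP[m [c [v [Gv ->]]]].
  elim/big_ind: _ => [|x y [cx Wx] [cy Wy]|i _].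
  + exists (fun=> 0); rewrite big1 ?subrr => [|i _]; last by rewrite scale0r.
    exact/WP/kspan0.
  + exists (fun i => cx i + cy i).
    under eq_bigr => i _ do rewrite scalerDl.
    rewrite big_split /= opprD addrACA; apply/WP.
    by apply: kspanD; apply/WP.
  have [t [Gt ->]] := Gv i; have [st|st] := boolP (t \in s).
    pose d t' := c i * (t' == t)%:R.
    exists (fun j => d (nth t1 s j)); rewrite (bsE d) (bigD1_seq t) //= big1 => [|t'].
      by rewrite /d eqxx mulr1 addr0 subrr; apply/WP/kspan0.
    by rewrite /d => /negPf->; rewrite mulr0 scale0r.
  exists (fun=> 0); rewrite big1 ?subr0 => [|j _]; last by rewrite scale0r.
  apply/WP/kspanZ/kspan_in; exists t; split=> //.
  by move: st; rewrite sP Gt negbK.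
move=> c /WP/kspan_fam_uniq[r [d [ur Gr sumE]]] i.
have rs : ~~ has (mem s) r.
  by apply/hasPn => t /(allP Gr) G2t /=; rewrite sP G2t andbF.
pose e t := if insub (index t s) is Some j then c j else 0.
have eE (j : 'I_(size s)) : e (nth t1 s j) = c j.
  by rewrite /e index_uniq //; case: insubP => [j' _ /val_inj->|]; rewrite ?ltn_ord.
pose f t := if t \in s then e t else - d t.
have := indG (s ++ r) f; rewrite cat_uniq us ur rs all_cat.
have -> : all G1 s by apply/allP => t; rewrite sP => /andP[].
rewrite (sub_all sub12 Gr) => /(_ isT isT).
have f0 : \sum_(t <- s ++ r) f t *: b t = 0.
  rewrite big_cat /= [X in X + _](_ : _ = \sum_(t <- s) e t *: b t); last first.
    by rewrite big_seq [RHS]big_seq; apply: eq_bigr => t ts; rewrite /f ts.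
  rewrite -(bsE e) (eq_bigr (fun j => c j *: bs j)) => [|j _]; last by rewrite eE.
  rewrite sumE [X in _ + X](_ : _ = - \sum_(t <- r) d t *: b t) ?subrr //.
  rewrite -sumrN big_seq [RHS]big_seq; apply: eq_bigr => t tr.
  by have /= /negPf ts := hasPn rs t tr; rewrite /f ts scaleNr.
move=> /(_ f0 (nth t1 s i)); rewrite mem_cat mem_nth // /f mem_nth // eE.
exact.
Qed.

End Spans.

(** * Fractions with linear denominators *)

Section Fractions.
Variables (K : fieldType) (V : vectType K) (n : nat) (al : 'I_n -> 'Hom(V, K^o)).
Hypothesis al_neq0 : forall i, al i != 0.
Local Notation l := (\dim {:V}).
Implicit Types (B C U : {set 'I_n}) (i j : 'I_n) (e : 'X_{1..n}) (mu : 'X_{1..l}).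
Implicit Types (f g : polfun V) (x y : ratfun V).

HB.instance Definition _ := GRing.RMorphism.copy (@rat_of K V) (@tofrac (polfun V)).

Lemma rat_of_eq0 f : (rat_of f == 0) = (f == 0).
Proof. exact: tofrac_eq0. Qed.

Lemma scale_ratE (c : K) x : c *: x = rat_of c%:MP * x.
Proof. by []. Qed.

Lemma rat_ofZ c f : rat_of (c *: f) = c *: rat_of f.
Proof. by rewrite scale_ratE -rmorphM mul_mpolyC. Qed.

Definition alform i : polfun V := lform (row i (coef_mx al)).

Lemma linform_alform i : linform (al i) = alform i.
Proof. exact: linform_coef. Qed.

Lemma alform_neq0 i : alform i != 0.
Proof.
rewrite /alform lform_eq0; apply: contra (al_neq0 i) => /eqP i0.
apply/eqP/lfunP => v; rewrite lfunE /= (coord_vbasis (memvf v)) linear_sum big1 // => j _.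
have /rowP/(_ j) := i0; rewrite !mxE => aij; by rewrite linearZ /= aij scaler0.
Qed.

Definition supp (m : nat) (e : 'X_{1..m}) : {set 'I_m} := [set i | e i != 0%N].

Definition den e : polfun V := \prod_i alform i ^+ e i.

Definition frac e f : ratfun V := rat_of f / rat_of (den e).

Fact frac_is_linear e : linear (frac e).
Proof.
by move=> c f g; rewrite /frac rmorphD /= mulrDl rat_ofZ !scale_ratE mulrA.
Qed.
HB.instance Definition _ e :=
  GRing.isLinear.Build K (polfun V) (ratfun V) _ (frac e) (frac_is_linear e).

Lemma den_neq0 e : den e != 0.
Proof. by apply/prodf_neq0 => i _; rewrite expf_neq0 ?alform_neq0. Qed.

Lemma den0 : den 0%MM = 1.
Proof. by rewrite /den big1 // => i _; rewrite mnm0E. Qed.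

Lemma denD e e' : den (e + e') = den e * den e'.
Proof. by rewrite -big_split /=; apply: eq_bigr => i _; rewrite mnmDE exprD. Qed.

Lemma den1 i : den U_(i) = alform i.
Proof.
rewrite /den (bigD1 i) //= big1 ?mulr1 => [|j /negPf ij]; rewrite mnm1E.
  by rewrite eqxx.
by rewrite eq_sym ij.
Qed.

Lemma denMn i m : den (U_(i) *+ m) = alform i ^+ m.
Proof.
elim: m => [|m IHm]; first by rewrite mulm0n den0.
by rewrite mulmS denD den1 IHm exprS.
Qed.

Lemma fracMr e e' f : frac (e + e') (f * den e') = frac e f.
Proof.
rewrite /frac denD !rmorphM /= invfM mulrACA divff ?mulr1 //.
by rewrite rat_of_eq0 den_neq0.
Qed.

Lemma fracMalform e i f : e i != 0%N -> frac e (f * alform i) = frac (e - U_(i)) f.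
Proof.
rewrite -lep1mP => /submK {1}<-; by rewrite -den1 fracMr.
Qed.

Lemma dep_alform i B : dep al i B ->
  exists c : 'I_n -> K, alform i = \sum_(j in B) c j *: alform j.
Proof.
rewrite depE => /span_mxP[c E]; exists c; rewrite /alform E linear_sum.
by apply: eq_bigr => j _; rewrite linearZ.
Qed.

End Fractions.
(** * The basis attached to no broken circuit sets *)

Section Basis.
Variables (K : fieldType) (V : vectType K) (n : nat) (al : 'I_n -> 'Hom(V, K^o)).
Hypothesis al_neq0 : forall i, al i != 0.
Local Notation l := (\dim {:V}).
Implicit Types (B C U : {set 'I_n}) (i j : 'I_n) (e : 'X_{1..n}) (mu : 'X_{1..l}).
Implicit Types (f g : polfun V) (x y : ratfun V).
Local Notation idx := ('X_{1..n} * 'X_{1..l})%type.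
Local Notation den := (den al).
Local Notation frac := (frac al).
Local Notation alform := (alform al).

Definition coords B : {set 'I_l} := free_coords (span_mx al B).

Definition nbc_idx (t : idx) : bool :=
  nbc al (supp t.1) && (supp t.2 \subset coords (supp t.1)).

Definition nbc_frac (t : idx) : ratfun V := frac t.1 'X_[t.2].

Definition nbc_box p q : pred idx :=
  fun t => [&& nbc_idx t, mdeg t.2 <= p & mdeg t.1 <= q]%N.

(** Modulo the forms of the denominator, a variable outside [coords] is a
    combination of variables inside. The terms in which a form appears cancel
    against the denominator, whose degree drops; the others have one variable
    fewer outside [coords]. *)
Lemma straighten_coords p q e : nbc al (supp e) ->
    (forall e' mu', (mdeg e' < mdeg e)%N -> (mdeg mu' <= p)%N ->
       kspan (fam nbc_frac (nbc_box p q)) (frac e' 'X_[mu'])) ->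
    (mdeg e <= q)%N ->
  forall mu, (mdeg mu <= p)%N -> kspan (fam nbc_frac (nbc_box p q)) (frac e 'X_[mu]).
Proof.
move=> nbe IHe leq mu.
pose J := coords (supp e); pose bad (mu : 'X_{1..l}) := (\sum_(j | j \notin J) mu j)%N.
move: {2}(bad mu) (leqnn (bad mu)) => m; elim: m mu => [|m IHm] mu lem lep.
  apply: kspan_in; exists (e, mu); split=> //.
  rewrite /nbc_box /nbc_idx /= nbe lep leq !andbT; apply/subsetP => j.
  rewrite inE; apply: contraR => jJ; move: lem; rewrite leqn0 sum_nat_eq0.
  by move=> /forallP/(_ j); rewrite jJ.
have [subJ|/subsetPn[j]] := boolP (supp mu \subset J).
  apply: IHm => //; rewrite /bad big1 // => j jJ; apply/eqP.
  by apply: contraR jJ => muj; apply: (subsetP subJ); rewrite inE.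
rewrite inE -lep1mP => /submK muE jJ; set mu' := (mu - U_(j))%MM in muE.
have degmu : mdeg mu = (mdeg mu').+1 by rewrite -muE mdegD mdeg1 addn1.
have badE k : bad (mu' + U_(k))%MM = (bad mu' + (k \notin J))%N.
  rewrite /bad; under eq_bigr do rewrite mnmDE.
  rewrite big_split /=; congr (_ + _)%N; under eq_bigr do rewrite mnm1E.
  case kJ: (k \in J).
    by rewrite big1 // => i iJ; case: eqP => // ki; rewrite -ki kJ in iJ.
  by rewrite (bigD1 k) ?kJ //= eqxx big1 // => i /andP[_]; rewrite eq_sym => /negPf->.
pose P := proj_coords (span_mx al (supp e)).
have /span_mxP[c cE] : (row j (1%:M - P) <= span_mx al (supp e))%MS.
  exact: submx_trans (row_sub _ _) (sub_1_proj_coords _).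
have XE : 'X_j = \sum_(k < l) P j k *: 'X_k + \sum_(i in supp e) c i *: alform i.
  transitivity (lform (row j P) + lform (row j (1%:M - P))).
    by rewrite -linearD /= -linearD /= addrCA subrr addr0 row1 lform_delta.
  congr (_ + _); first by apply: eq_bigr => k _; rewrite mxE.
  by rewrite cE linear_sum; apply: eq_bigr => i _; rewrite linearZ.
have -> : frac e 'X_[mu] = \sum_(k < l) P j k *: frac e 'X_[mu' + U_(k)] +
    \sum_(i in supp e) c i *: frac (e - U_(i))%MM 'X_[mu'].
  rewrite -{1}muE mpolyXD XE mulrDr linearD; congr (_ + _).
    rewrite mulr_sumr linear_sum; apply: eq_bigr => k _.
    by rewrite -scalerAr linearZ /= mpolyXD.
  rewrite mulr_sumr linear_sum; apply: eq_bigr => i; rewrite inE => ei.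
  by rewrite -scalerAr linearZ /= fracMalform.
apply: kspanD; apply: kspan_sum => k _ kP.
  have [kJ|kJ] := boolP (k \in J); last first.
    by rewrite /P proj_coords0 // scale0r; apply: kspan0.
  apply/kspanZ/IHm; last by rewrite mdegD mdeg1 addn1 -degmu.
  by move: lem; rewrite -muE !badE jJ kJ addn0 addn1 ltnS.
apply/kspanZ/IHe; last by apply: leq_trans lep; rewrite degmu.
have /submK {2}<- : (U_(k) <= e)%MM by move: kP; rewrite inE -lep1mP.
by rewrite mdegD mdeg1 addn1.
Qed.

(** If [al i] is a combination of later forms [al j] of the denominator, then
    multiplying by [al i / al i] trades one factor [al j] for [al i] in each term;
    the degree of the denominator is unchanged and its weight [mnmwgt], in which
    the index [i] counts for [i.+1], decreases. *)
Lemma straighten p q e mu : (mdeg mu <= p)%N -> (mdeg e <= q)%N ->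
  kspan (fam nbc_frac (nbc_box p q)) (frac e 'X_[mu]).
Proof.
move=> lep; move: {2}(mdeg e) (leqnn (mdeg e)) => d.
elim/ltn_ind: d e mu lep => d IHd e mu lep led leq.
move: {2}(mnmwgt e) (leqnn (mnmwgt e)) => w.
elim/ltn_ind: w e led leq => w IHw e led leq lew.
have [nbe|/forallPn[i]] := boolP (nbc al (supp e)).
  apply: straighten_coords => // e' mu' lte le'.
  apply: (IHd (mdeg e')) => //; first exact: leq_trans lte led.
  exact: leq_trans (ltnW lte) leq.
rewrite negbK => /dep_alform[c cE].
have -> : frac e 'X_[mu] = \sum_(j in supp e :&: above i)
    c j *: frac (e + U_(i) - U_(j))%MM 'X_[mu].
  rewrite -(fracMr al_neq0 _ U_(i)) den1 cE mulr_sumr linear_sum.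
  apply: eq_bigr => j; rewrite !inE => /andP[ej _].
  by rewrite -scalerAr linearZ /= fracMalform // mnmDE addn_eq0 negb_and ej.
apply: kspan_sum => j _; rewrite !inE => /andP[ej ij]; apply: kspanZ.
have /submK : (U_(j) <= e + U_(i))%MM by rewrite lep1mP mnmDE addn_eq0 negb_and ej.
set e' := (_ - _)%MM => e'E.
have dE : mdeg e' = mdeg e.
  by apply/eqP; rewrite -(eqn_add2r 1) -{1}(mdeg1 j) -mdegD e'E mdegD mdeg1.
have wE : (mnmwgt e' < mnmwgt e)%N.
  have : (mnmwgt e' + j.+1 = mnmwgt e + i.+1)%N.
    by rewrite -!mnmwgt1 -!mnmwgtD e'E.
  by move: ij; lia.
by apply: (IHw (mnmwgt e')); rewrite ?dE // (leq_trans wE).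
Qed.

(** * Linear independence by specialization *)

(** A relation and not a function: a fraction has a value under the substitution
    [P] only if it can be written with a denominator that [P] does not kill, and
    [specialize0] makes this value unique. *)
Definition specialize (P : 'M[K]_l) x y := exists f g,
  [/\ subst_mx P g != 0, x = rat_of f / rat_of g
    & y = rat_of (subst_mx P f) / rat_of (subst_mx P g)].

Lemma specialize0 P y : specialize P 0 y -> y = 0.
Proof.
case=> f [g [Pg0 /esym/eqP + ->]]; rewrite mulf_eq0 invr_eq0 !rat_of_eq0.
case/orP=> [/eqP->|/eqP g0]; first by rewrite !rmorph0 mul0r.
by rewrite g0 rmorph0 eqxx in Pg0.
Qed.

Lemma specializeZ P c x y : specialize P x y -> specialize P (c *: x) (c *: y).
Proof.
case=> f [g [Pg0 -> ->]]; exists (c *: f), g; split=> //.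
  by rewrite rat_ofZ !scale_ratE mulrA.
by rewrite linearZ /= rat_ofZ !scale_ratE mulrA.
Qed.

Lemma specializeD P x x' y y' :
  specialize P x y -> specialize P x' y' -> specialize P (x + x') (y + y').
Proof.
case=> f [g [g0 -> ->]] [f' [g' [g'0 -> ->]]].
have subst_neq0 h : subst_mx P h != 0 -> h != 0.
  by apply: contra => /eqP->; rewrite rmorph0.
have addE h1 k1 h2 k2 : k1 != 0 -> k2 != 0 ->
    rat_of h1 / rat_of k1 + rat_of h2 / rat_of k2 =
    rat_of (h1 * k2 + h2 * k1) / rat_of (k1 * k2) :> ratfun V.
  move=> k1_neq0 k2_neq0; rewrite addf_div ?rat_of_eq0 //.
  by rewrite -[rat_of h1 * _]rmorphM -[rat_of h2 * _]rmorphM -rmorphD -rmorphM.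
exists (f * g' + f' * g), (g * g'); split.
- by rewrite rmorphM mulf_neq0.
- exact: addE (subst_neq0 _ g0) (subst_neq0 _ g'0).
rewrite (addE _ _ _ _ g0 g'0); congr (rat_of _ / rat_of _); last by rewrite rmorphM.
by rewrite rmorphD; congr (_ + _); rewrite rmorphM.
Qed.

Lemma specialize_sum P (I : eqType) (r : seq I) (F G : I -> ratfun V) :
    (forall t, t \in r -> specialize P (F t) (G t)) ->
  specialize P (\sum_(t <- r) F t) (\sum_(t <- r) G t).
Proof.
move=> FG; rewrite big_seq [X in specialize _ _ X]big_seq.
elim/big_ind2: _ => //; last by move=> x x' y y'; apply: specializeD.
by exists 0, 1; rewrite !rmorph1 !rmorph0 mul0r oner_eq0.
Qed.

(** The matrix of the projection, along the span of the forms of [U], onto the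
    variables of [coords U]. *)
Definition kill U := proj_coords (span_mx al U).

Lemma kill_alform U i : (subst_mx (kill U) (alform i) == 0) = dep al i U.
Proof.
rewrite depE subst_mx_lform lform_eq0; apply/eqP/idP => [i0|/submxP[D ->]].
  rewrite -[row i _]subr0 -[X in _ - X]i0 -{1}[row i _]mulmx1 -mulmxBr.
  by rewrite (submx_trans (submxMl _ _)) ?sub_1_proj_coords.
by rewrite -mulmxA mul_proj_coords0 mulmx0.
Qed.

Lemma kill_kill U U' f : U \subset U' ->
  subst_mx (kill U') (subst_mx (kill U) f) = subst_mx (kill U') f.
Proof.
move=> UU'; rewrite subst_mx_comp; congr (subst_mx _ f).
have /submxP[D DE] : (1%:M - kill U <= span_mx al U')%MS.
  by apply: submx_trans (sub_1_proj_coords _) _; apply: span_mxS.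
apply/esym/eqP; rewrite -subr_eq0 -{1}[kill U']mul1mx -mulmxBl DE.
by rewrite -mulmxA mul_proj_coords0 mulmx0.
Qed.

Lemma kill0 : kill set0 = 1%:M.
Proof.
apply/esym/eqP; rewrite -subr_eq0 -submx0.
apply: submx_trans (sub_1_proj_coords _) _.
by apply: span_mx_sub => i; rewrite inE.
Qed.

Lemma kill_free U mu : supp mu \subset coords U -> subst_mx (kill U) 'X_[mu] = 'X_[mu].
Proof.
move=> /subsetP muU; rewrite mpolyXE_id rmorph_prod; apply: eq_bigr => j _ /=.
have [->|muj] := eqVneq (mu j) 0%N; first by rewrite !expr0 rmorph1.
by rewrite rmorphXn /= subst_mxX row_proj_coords ?lform_delta // muU // inE.
Qed.

Definition mdrop (i : 'I_n) e : 'X_{1..n} :=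
  [multinom (if j == i then 0 else e j)%N | j < n].

Lemma mdropK i e : (mdrop i e + U_(i) *+ e i)%MM = e.
Proof.
apply/mnmP => j; rewrite mnmDE mnmE mulmnE mnm1E eq_sym.
by case: eqP => [->|]; rewrite ?mul1n ?mul0n ?addn0.
Qed.

(** The state of the recursion on the forms from the last to the first: the forms
    of [U] have been specialized to zero, the other forms at or after [k] have been
    discarded, and the forms before [k] may still occur in denominators. *)
Definition nbc_idx_over (k : nat) U : pred idx := fun t =>
  [&& [forall i, (i \in supp t.1) ==> (i < k)%N], nbc al (supp t.1 :|: U)
    & supp t.2 \subset coords (supp t.1 :|: U)].

Definition kill_frac U (t : idx) : ratfun V :=
  rat_of (subst_mx (kill U) 'X_[t.2]) / rat_of (subst_mx (kill U) (den t.1)).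

(** In a vanishing combination look at the terms with a pole of maximal order along
    the last form [alform ko] still allowed. Multiplying by this power of the form
    and specializing the form to zero kills all other terms and leaves a relation
    of the same kind for [ko |: U]; there the denominators survive because the set
    [ko |: U] is nbc, so that no earlier form lies in its span. Thus these terms
    have zero coefficients, and the maximal order decreases. *)
Lemma lin_indep_kill k U : (k <= n)%N -> (forall i, i \in U -> (k <= i)%N) ->
  lin_indep (kill_frac U) (nbc_idx_over k U).
Proof.
elim: k U => [|k IHk] U lekn Uk.
  move=> r c ur /allP Gr sum0.
  have e0 t : t \in r -> t.1 = 0%MM.
    move=> /Gr/and3P[/forallP t1 _ _]; apply/mnmP => i; rewrite mnm0E.
    by have := t1 i; rewrite implybF inE negbK => /eqP.
  move=> t tr; have : (\sum_(t <- r) c t *: 'X_[t.2] : polfun V) = 0.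
    apply/eqP; rewrite -rat_of_eq0 rmorph_sum; apply/eqP.
    rewrite -[RHS]sum0 big_seq [RHS]big_seq.
    apply: eq_bigr => t' tr' /=.
    rewrite rat_ofZ /kill_frac (e0 _ tr') den0 !rmorph1 divr1.
    rewrite kill_free //; have /and3P[_ _] := Gr _ tr'.
    rewrite (_ : supp t'.1 = set0) ?set0U // (e0 _ tr').
    by apply/setP => i; rewrite !inE mnm0E.
  move=> /(congr1 (mcoeff t.2)); rewrite mcoeff0 raddf_sum (bigD1_seq t) //=.
  rewrite mcoeffZ mcoeffX eqxx mulr1 big_seq_cond big1 ?addr0 // => t' /andP[tr' tt'].
  rewrite mcoeffZ mcoeffX; case: eqP => [t2|]; last by rewrite mulr0.
  by case/eqP: tt'; rewrite [t']surjective_pairing [t]surjective_pairing t2 !e0.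
pose ko := Ordinal lekn.
have neq_ko i : i != ko -> i != k :> nat by rewrite -val_eqE.
(* [M] bounds the order of the pole along [alform ko] *)
suff indM M r c : uniq r -> all (nbc_idx_over k.+1 U) r ->
    (forall t, t \in r -> t.1 ko <= M)%N ->
    \sum_(t <- r) c t *: kill_frac U t = 0 -> forall t, t \in r -> c t = 0.
  move=> r c ur Gr; apply: (indM (\max_(t <- r) t.1 ko)%N) => // t tr.
  exact: (@leq_bigmax_seq _ r xpredT (fun t : idx => t.1 ko)).
elim: M r => [|M IHM] r ur Gr leM sum0.
  apply: (IHk U (ltnW lekn)) => // [i /Uk /ltnW //|].
  apply/allP => t tr; have /and3P[/forallP t1 t2 t3] := allP Gr _ tr.
  rewrite /nbc_idx_over t2 t3 !andbT; apply/forallP => i; apply/implyP => ti.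
  have := implyP (t1 i) ti; rewrite ltnS leq_eqVlt => /orP[/eqP ik|//].
  have := leM _ tr; rewrite leqn0 => /eqP tk; move: ti; rewrite inE.
  by rewrite (_ : i = ko) ?tk //; apply: val_inj.
have [/hasP[t0 t0r /eqP t0M]|/hasPn noM] :=
  boolP (has (fun t : idx => t.1 ko == M.+1) r); last first.
  apply: IHM => // t tr; have := leM _ tr; rewrite leq_eqVlt ltnS => /orP[tM|//].
  by case/negP: (noM _ tr).
have nbcU : nbc al (ko |: U).
  have /and3P[_ + _] := allP Gr _ t0r; apply: nbcS.
  by rewrite setSU // sub1set inE t0M.
have aboveU i : (i < k)%N -> ~~ dep al i (ko |: U).
  move=> ik; have /forallP/(_ i) := nbcU; apply: contra; apply: depS.
  apply/subsetP => j jU; rewrite in_setI jU inE; move: jU; rewrite !inE.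
  by case/orP=> [/eqP->//|/Uk]; apply: leq_trans (ltnW _).
have a0 : subst_mx (kill U) (alform ko) != 0.
  rewrite kill_alform; have /forallP/(_ ko) := nbcU; apply: contra; apply: depS.
  by apply/subsetP => j jU; rewrite !inE jU orbT /=; apply: Uk.
set U' := ko |: U in nbcU aboveU.
have a'0 : subst_mx (kill U') (alform ko) = 0.
  apply/eqP; rewrite kill_alform; apply: bigcapv_inf (subvv _); exact: setU11.
have den'0 t : t \in r -> subst_mx (kill U') (den (mdrop ko t.1)) != 0.
  move=> tr; rewrite rmorph_prod; apply/prodf_neq0 => i _ /=; rewrite rmorphXn mnmE /=.
  case: (i =P ko) => [_|/eqP ik]; first by rewrite expr0 oner_eq0.
  have [->|ti] := eqVneq (t.1 i) 0%N; first by rewrite expr0 oner_eq0.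
  apply: expf_neq0; rewrite kill_alform; apply: aboveU.
  have /and3P[/forallP/(_ i) + _ _] := allP Gr _ tr.
  by rewrite inE ti /= ltnS leq_eqVlt (negPf (neq_ko _ ik)).
set a := rat_of (subst_mx (kill U) (alform ko)).
pose drop (t : idx) : idx := (mdrop ko t.1, t.2).
pose top (t : idx) := t.1 ko == M.+1.
have kk f : subst_mx (kill U') (subst_mx (kill U) f) = subst_mx (kill U') f.
  exact/kill_kill/subsetUr.
(* [drop] removes the pole along [alform ko]; [top] holds if its order is maximal *)
have spec_top t : t \in r ->
    specialize (kill U') (kill_frac U t * a ^+ M.+1)
      (if top t then kill_frac U' (drop t) else 0).
  move=> tr; have tM := leM _ tr.
  exists (subst_mx (kill U) ('X_[t.2] * alform ko ^+ (M.+1 - t.1 ko))).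
  exists (subst_mx (kill U) (den (mdrop ko t.1))).
  split; first by rewrite kk; apply: den'0.
    rewrite /kill_frac -{1}(mdropK ko t.1) denD denMn.
    have a_neq0 : a ^+ t.1 ko != 0 by apply: expf_neq0; rewrite rat_of_eq0.
    rewrite !rmorphM /= !rmorphXn /= -/a -{1}(subnK tM) exprD invfM -!mulrA.
    by congr (_ * _); rewrite (mulrC (a ^+ (_ - _))) mulKf // mulrC.
  rewrite !kk /top; case: eqP => [->|/eqP tk].
    by rewrite subnn expr0 mulr1.
  rewrite rmorphM /= rmorphXn /= a'0 expr0n subn_eq0.
  by rewrite leqNgt ltn_neqAle tk tM /= mulr0 rmorph0 mul0r.
have top_sum0 : \sum_(t <- [seq t <- r | top t]) c t *: kill_frac U' (drop t) = 0.
  rewrite big_filter big_mkcond /=.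
  apply: (@specialize0 (kill U')).
  rewrite [X in specialize _ X _](_ : 0 =
    \sum_(t <- r) c t *: (kill_frac U t * a ^+ M.+1)); last first.
    rewrite -[LHS](mul0r (a ^+ M.+1)) -[X in X * _]sum0 mulr_suml; apply: eq_bigr => t _.
    by rewrite !scale_ratE mulrA.
  have -> : \sum_(t <- r) (if top t then c t *: kill_frac U' (drop t) else 0) =
      \sum_(t <- r) c t *: (if top t then kill_frac U' (drop t) else 0).
    by apply: eq_bigr => t _; case: ifP; rewrite ?scaler0.
  by apply: specialize_sum => t tr; apply/specializeZ/spec_top.
pose undrop (t : idx) : idx := ((t.1 + U_(ko) *+ M.+1)%MM, t.2).
have dropK t : t \in [seq t <- r | top t] -> undrop (drop t) = t.
  rewrite mem_filter => /andP[/eqP tM _].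
  by rewrite /undrop /= -tM mdropK -surjective_pairing.
have c_top t : t \in [seq t <- r | top t] -> c t = 0.
  move=> tr; rewrite -(dropK _ tr).
  have := IHk U' (ltnW lekn) _ [seq drop t | t <- [seq t <- r | top t]] (c \o undrop).
  apply; last exact: map_f.
  - by move=> i; rewrite !inE => /orP[/eqP->//|/Uk/ltnW].
  - rewrite map_inj_in_uniq ?filter_uniq //.
    by move=> t1 t2 /dropK {2}<- /dropK {2}<- ->.
  - apply/allP => _ /mapP[{t0 t0r t0M}t0 + ->].
    rewrite mem_filter => /andP[/eqP t0M t0r].
    have /and3P[/forallP t1 t2 t3] := allP Gr _ t0r.
    have suppE : supp (mdrop ko t0.1) :|: U' = supp t0.1 :|: U.
      by apply/setP => i; rewrite !inE mnmE; case: (i =P ko) => [->|]; rewrite ?t0M //.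
    rewrite /nbc_idx_over /= suppE t2 t3 !andbT; apply/forallP => i; apply/implyP.
    rewrite inE mnmE; case: (i =P ko) => // /eqP ik ti.
    by have := implyP (t1 i); rewrite inE ti ltnS leq_eqVlt (negPf (neq_ko _ ik)); apply.
  rewrite big_map -[RHS]top_sum0 big_seq [RHS]big_seq.
  by apply: eq_bigr => t' tr' /=; rewrite dropK.
move=> t tr; have [tt|tt] := boolP (top t); first by apply: c_top; rewrite mem_filter tt.
apply: (IHM [seq t <- r | ~~ top t] (filter_uniq _ ur)).
- by apply/allP => t'; rewrite mem_filter => /andP[_ /(allP Gr)].
- move=> t'; rewrite mem_filter /top => /andP[/negPf t't /leM].
  by rewrite leq_eqVlt t't ltnS.
- rewrite big_filter -[RHS]sum0 [RHS](bigID top) /= [X in _ = X + _]big1_seq ?add0r //.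
  by move=> t' /andP[tt' tr']; rewrite c_top ?scale0r // mem_filter tt'.
by rewrite mem_filter tt.
Qed.

Lemma lin_indep_nbc : lin_indep nbc_frac nbc_idx.
Proof.
move=> r c ur Gr sum0; apply: (@lin_indep_kill n set0 (leqnn n) _ r c ur) => //.
- by move=> i; rewrite inE.
- apply/allP => t /(allP Gr)/andP[t1 t2]; rewrite /nbc_idx_over setU0 t1 t2 !andbT.
  by apply/forallP => i; rewrite ltn_ord implybT.
by rewrite -[RHS]sum0; apply: eq_bigr => t _; rewrite /kill_frac kill0 !subst_mx1.
Qed.

End Basis.
(** * The bifiltration in terms of the basis *)

Section Divisibility.
Variables (K : fieldType) (l : nat) (u : 'rV[K]_l).
Implicit Types (f g h : {mpoly K[l]}).

Lemma sub_subst_dvd f : exists h, f - subst_mx (proj_coords u) f = lform u * h.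
Proof.
pose D f := exists h, f - subst_mx (proj_coords u) f = lform u * h.
have DC c : D c%:MP by exists 0; rewrite subst_mxC subrr mulr0.
have DD f1 f2 : D f1 -> D f2 -> D (f1 + f2).
  move=> [h1 E1] [h2 E2]; exists (h1 + h2).
  by rewrite rmorphD /= opprD addrACA E1 E2 mulrDr.
have DM f1 f2 : D f1 -> D f2 -> D (f1 * f2).
  move=> [h1 E1] [h2 E2]; exists (h1 * f2 + subst_mx (proj_coords u) f1 * h2).
  rewrite rmorphM /= mulrDr mulrA -E1 mulrCA -E2 mulrBl mulrBr.
  by rewrite addrA subrK.
rewrite -/(D f) (mpolyE f); elim/big_ind: _ => [|//|m _].
  by exists 0; rewrite rmorph0 subrr mulr0.
rewrite -mul_mpolyC; apply: (DM) => //; rewrite mpolyXE_id.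
elim/big_ind: _ => [|//|j _]; first by rewrite -mpolyC1.
elim: (m j) => [|k IHk]; first by rewrite expr0 -mpolyC1.
rewrite exprS; apply: (DM) => //.
have /submxP[c cE] : (row j (1%:M - proj_coords u) <= u)%MS.
  exact: submx_trans (row_sub _ _) (sub_1_proj_coords _).
exists (c 0 0)%:MP; rewrite subst_mxX -lform_delta -linearB /= -row1 -linearB /= cE.
by rewrite [c]mx11_scalar mul_scalar_mx linearZ /= mulrC mul_mpolyC mxE eqxx.
Qed.

(** Linear forms are prime because the kernel of the projection along [u],
    whose values lie in a domain, is the ideal generated by [lform u]. *)
Lemma lform_prime f g h : lform u * h = f * g ->
  (exists f', f = lform u * f') \/ (exists g', g = lform u * g').
Proof.
move=> uh; have u0 : subst_mx (proj_coords u) (lform u) = 0.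
  by rewrite subst_mx_lform mul_proj_coords0 linear0.
have := congr1 (subst_mx (proj_coords u)) uh.
rewrite !rmorphM /= u0 mul0r => /esym/eqP; rewrite mulf_eq0.
by case/orP=> /eqP E; [left; have := sub_subst_dvd f | right; have := sub_subst_dvd g];
  rewrite E subr0.
Qed.

End Divisibility.

Section Bifiltration.
Variables (K : fieldType) (V : vectType K) (Delta : {fset 'Hom(V, K^o)}).
Variables (n : nat) (al : 'I_n -> 'Hom(V, K^o)).
Hypothesis alP : forall a, a \in Delta <-> exists i, al i = a.
Hypothesis al_neq0 : forall i, al i != 0.
Local Notation l := (\dim {:V}).
Implicit Types (i j : 'I_n) (e : 'X_{1..n}) (mu : 'X_{1..l}).
Implicit Types (f g h : polfun V) (x y : ratfun V).
Local Notation den := (den al).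
Local Notation frac := (frac al).
Local Notation alform := (alform al).

Lemma degM f g : f != 0 -> g != 0 -> deg (f * g) = (deg f + deg g)%N.
Proof.
move=> f0 g0; rewrite /deg msizeM // (mpolySpred _ f0) (mpolySpred _ g0).
by rewrite addSn addnS.
Qed.

Lemma deg_alform i : deg (alform i) = 1%N.
Proof.
have a0 := alform_neq0 al_neq0 i; apply/eqP; rewrite eqn_leq; apply/andP; split.
  rewrite /deg -subn1 leq_subLR; apply: leq_trans (msize_sum _ _ _) _.
  apply/bigmax_leqP => j _; apply: leq_trans (msizeZ_le _ _) _.
  by rewrite msizeX mdeg1.
rewrite lt0n /deg; apply/eqP => d0; have := mpolySpred mdeg a0; rewrite d0 => s1.
have /msize_poly1P[c _ cE] : msize (alform i) == 1%N by rewrite s1.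
case/eqP: a0; rewrite /alform (_ : row i _ = 0) ?linear0 //.
apply/rowP => j; rewrite -mcoeff_lform -/(alform i) cE mcoeffC mnm1_eq0 mulr0.
by rewrite mxE.
Qed.

Lemma deg_den e : deg (den e) = mdeg e.
Proof.
rewrite mdegE; pose D f m := f != 0 /\ deg f = m.
suff : D (den e) (\sum_i e i)%N by case.
apply: (big_ind2 D) => [|f m g k [f0 <-] [g0 <-]|i _].
  by split; rewrite ?oner_eq0 // /deg msize1.
  by split; rewrite ?mulf_neq0 ?degM.
elim: (e i) => [|k [k0 dk]]; first by split; rewrite ?oner_eq0 // /deg msize1.
split; first by rewrite expf_neq0 ?alform_neq0.
by rewrite exprS degM ?alform_neq0 // dk deg_alform.
Qed.

Lemma inR_frac x : inR Delta x -> exists e f, x = frac e f.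
Proof.
elim=> [f|a /alP[i <-]|{}x y _ [e [f ->]] _ [e' [f' ->]]
       |{}x y _ [e [f ->]] _ [e' [f' ->]]].
- by exists 0%MM, f; rewrite /frac den0 rmorph1 divr1.
- by exists U_(i)%MM, 1; rewrite /frac den1 rmorph1 div1r linform_alform.
- exists (e + e')%MM, (f * den e' + f' * den e); rewrite linearD /= fracMr //.
  by rewrite [(e + e')%MM]addmC fracMr.
- by exists (e + e')%MM, (f * f'); rewrite /frac denD !rmorphM /= mulf_div.
Qed.

Lemma frac_inR e f : inR Delta (frac e f).
Proof.
apply: inR_mul; first exact: inR_pol.
rewrite /den rmorph_prod -prodfV; elim/big_ind: _ => [|x y|i _].
- by rewrite -(rmorph1 (@rat_of K V)); apply: inR_pol.
- exact: inR_mul.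
rewrite /= rmorphXn -exprVn; elim: (e i) => [|k IHk].
  by rewrite expr0 -(rmorph1 (@rat_of K V)); apply: inR_pol.
rewrite exprS; apply: inR_mul IHk.
by rewrite /= -linform_alform; apply: inR_inv; apply/alP; exists i.
Qed.

(** Linear forms being prime, each factor of [den e] divides [h] or [g]. The
    factors dividing [g] are kept as the new denominator; they account for no more
    than the degree of [g]. The factors dividing [h] are cancelled. *)
Lemma frac_cancel e f g h : g != 0 -> f * den e = h * g ->
  exists e' f', [/\ rat_of f / rat_of g = frac e' f', (mdeg e' <= deg g)%N
                  & (deg f' <= deg f)%N].
Proof.
move: {2}(mdeg e) (erefl (mdeg e)) => d; elim: d e f g h => [|d IHd] e f g h de g0 E.
  move/eqP: de E; rewrite mdeg_eq0 => /eqP->; rewrite den0 mulr1 => ->.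
  exists 0%MM, h; rewrite mdeg0; split=> //.
    by rewrite /frac den0 rmorph1 divr1 rmorphM /= mulfK ?rat_of_eq0.
  have [->|h0] := eqVneq h 0; first by rewrite mul0r.
  by rewrite degM ?leq_addr.
have [i ei] : exists i, e i != 0%N.
  apply: contrapT => /forallNP e0; suff e00: e = 0%MM by rewrite e00 mdeg0 in de.
  by apply/mnmP => i; rewrite mnm0E; apply/eqP; have /negP := e0 i; rewrite negbK.
move: ei; rewrite -lep1mP => /submK; set e' := (_ - _)%MM => eE.
have de' : mdeg e' = d by move: de; rewrite -eE mdegD mdeg1 addn1 => -[].
move: E; rewrite -eE denD den1 mulrA => E.
have a0 := alform_neq0 al_neq0 i.
have [[h' hE]|[g' gE]] : (exists h', h = alform i * h') \/ (exists g', g = alform i * g').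
  by apply: (@lform_prime _ _ _ _ _ (f * den e')); rewrite -E mulrC.
  by apply: (IHd e' f g h' de' g0); apply: (mulIf a0); rewrite E hE -mulrA mulrC.
have g'0 : g' != 0 by apply: contra g0 => /eqP g'0; rewrite gE g'0 mulr0.
have E' : f * den e' = h * g' by apply: (mulIf a0); rewrite E gE mulrCA mulrC.
have [e'' [f'' [fE le lf]]] := IHd _ _ _ _ de' g'0 E'.
exists (e'' + U_(i))%MM, f''; split=> //.
  rewrite /frac denD den1 gE [alform i * _]mulrC !rmorphM /= !invfM !mulrA fE.
  by rewrite /frac.
by rewrite mdegD mdeg1 gE degM // deg_alform addn1 add1n ltnS.
Qed.

Lemma RfilP (p q : nat) x :
  Rfil Delta p q x <-> kspan (fam (nbc_frac al) (nbc_box al p q)) x.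
Proof.
rewrite /Rfil; split; last first.
  apply: kspan_sub => y [[e mu] [/and3P[_ /= lep leq] ->]].
  apply: kspan_in; split.
    exact: (frac_inR e).
  exists 'X_[mu], (den e); rewrite den_neq0 // deg_den leq; split=> //.
  by rewrite /deg msizeX.
move=> [m [c [y [yP ->]]]]; apply: kspan_sum => i _ _; apply: kspanZ.
have [yR [f [g [g0 yE lef leg]]]] := yP i.
have [e [h yE']] := inR_frac yR.
have [|e' [f' [fE le' lef']]] := @frac_cancel e f g h g0.
  have := congr1 (fun z => z * rat_of g * rat_of (den e)) (etrans (esym yE) yE').
  rewrite divfK ?rat_of_eq0 // /frac mulrAC divfK ?rat_of_eq0 ?den_neq0 //.
  by rewrite -!rmorphM /= => /eqP; rewrite tofrac_eq => /eqP.
rewrite yE fE (mpolyE f') linear_sum; apply: kspan_sum => mu mf' _.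
rewrite linearZ; apply/kspanZ/straighten => //; last exact: leq_trans leg.
have := msize_mdeg_lt mf'; move: (leq_trans lef' lef); rewrite /deg; lia.
Qed.

End Bifiltration.
(** * Counting with formal power series *)

Section FpsCoefficients.
Variable R : comNzRingType.
Implicit Types (f g : fps R).

Definition fps_geom : fps R := FPS (fun=> 1).
Definition fps_pos : fps R := FPS (fun k => (0 < k)%:R).

Lemma fps_geomK : fps_geom * (1 - fpsX R) = 1.
Proof. exact: fps_geomE. Qed.

Lemma fps_posE : fps_pos = fpsX R / (1 - fpsX R).
Proof.
have u1X := fps_unit_subX R; apply: (mulIr u1X); rewrite divrK //.
have -> : fps_pos = fps_geom - 1.
  by apply: fpsP => -[|k] /=; rewrite ?subrr ?subr0.
by rewrite mulrBl fps_geomK mul1r opprB addrCA subrr addr0.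
Qed.

Lemma fcoef_sum (I : Type) (r : seq I) (P : pred I) (F : I -> fps R) q :
  (\sum_(i <- r | P i) F i) q = \sum_(i <- r | P i) F i q.
Proof. exact: (big_morph (fun f : fps R => f q)). Qed.

Lemma fcoefMn f m q : (f *+ m) q = f q *+ m.
Proof. by elim: m => [|m IHm]; rewrite ?mulr0n // !mulrS -IHm. Qed.

Lemma fcoefCM a f q : (fpsC a * f) q = a * f q.
Proof.
rewrite /= big_ord_recl /= subn0 big1 ?addr0 // => i _.
by rewrite mul0r.
Qed.

Definition exponents m q : {set {ffun 'I_m -> 'I_q.+1}} :=
  [set phi : {ffun 'I_m -> 'I_q.+1} | (\sum_i phi i == q)%N].

(** Only the coefficients up to [q] matter, so that the product can be expanded
    after truncating the factors to polynomials. *)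
Lemma fcoef_prod m (F : 'I_m -> fps R) q :
  (\prod_i F i) q = \sum_(phi in exponents m q) \prod_i F i (phi i).
Proof.
pose T (f : fps R) : {poly R} := \poly_(k < q.+1) f k.
have coefT k : (k <= q)%N -> (\prod_i F i) k = (\prod_i T (F i))`_k.
  move: k; apply: (big_ind2 (fun (f : fps R) (p : {poly R}) =>
      forall k, (k <= q)%N -> f k = p`_k)) => [k _|f p g r fp gr k lek|i _ k lek].
  - by rewrite coef1; case: k.
  - rewrite coefM; apply: eq_bigr => j _; have lej : (j <= k)%N by rewrite -ltnS.
    by rewrite fp ?gr ?(leq_trans (leq_subr _ _)) ?(leq_trans lej).
  by rewrite coef_poly ltnS lek.
rewrite coefT //; under eq_bigr do rewrite /T poly_def.
rewrite bigA_distr_bigA /= coef_sum [RHS]big_mkcond /=; apply: eq_bigr => phi _.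
have -> : \prod_i (F i (phi i) *: 'X^(phi i)) =
    (\prod_i F i (phi i)) *: 'X^(\sum_i phi i) :> {poly R}.
  by rewrite scaler_prod; congr (_ *: _); rewrite expr_sum.
rewrite coefZ coefXn inE eq_sym; case: eqP => _; first by rewrite mulr1.
by rewrite mulr0.
Qed.

Lemma prod_natr_bool (I : finType) (b : pred I) :
  \prod_i (b i)%:R = [forall i, b i]%:R :> R.
Proof.
case: (boolP [forall i, b i]) => [/forallP bT|/forallPn[i bi]].
  by rewrite big1 // => i _; rewrite bT.
by rewrite (bigD1 i) //= (negPf bi) mul0r.
Qed.

Definition mnm_of m q (phi : {ffun 'I_m -> 'I_q.+1}) : 'X_{1..m} :=
  [multinom (phi i : nat) | i < m].

Lemma card_exponents m q (P : pred {ffun 'I_m -> 'I_q.+1}) :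
  \sum_(phi in exponents m q) (P phi)%:R =
  #|[set phi : {ffun 'I_m -> 'I_q.+1} in exponents m q | P phi]|%:R :> R.
Proof.
rewrite -sum1_card natr_sum [RHS](eq_bigl (fun phi => (phi \in exponents m q) && P phi)).
  by rewrite [RHS]big_mkcondr; apply: eq_bigr => phi _; case: (P phi).
by move=> phi; rewrite inE.
Qed.

Lemma card_supp_eq m q (B : {set 'I_m}) :
  #|[set phi : {ffun 'I_m -> 'I_q.+1} in exponents m q | supp (mnm_of phi) == B]|%:R =
  (fps_pos ^+ #|B|) q.
Proof.
have -> : fps_pos ^+ #|B| = \prod_i (if i \in B then fps_pos else 1).
  by rewrite -big_mkcond prodr_const.
rewrite fcoef_prod -card_exponents; apply: eq_bigr => phi _.
rewrite (eq_bigr (fun i => ((i \in B) == (phi i != 0 :> nat))%:R)); last first.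
  move=> i _; case: ifP => _ /=; first by rewrite lt0n; case: eqP.
  by case: (phi i) => -[|k].
rewrite prod_natr_bool; congr (nat_of_bool _)%:R; apply/eqP/forallP => [<- i|BE].
  by rewrite inE mnmE.
by apply/setP => i; rewrite inE mnmE (eqP (BE i)).
Qed.

Lemma card_supp_sub m q (J : {set 'I_m}) :
  #|[set phi : {ffun 'I_m -> 'I_q.+1} in exponents m q | supp (mnm_of phi) \subset J]|%:R =
  (fps_geom ^+ #|J|) q.
Proof.
have -> : fps_geom ^+ #|J| = \prod_i (if i \in J then fps_geom else 1).
  by rewrite -big_mkcond prodr_const.
rewrite fcoef_prod -card_exponents; apply: eq_bigr => phi _.
rewrite (eq_bigr (fun i => ((phi i != 0 :> nat) ==> (i \in J))%:R)); last first.
  move=> i _; case: ifP => _ /=; first by rewrite implybT.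
  by case: (phi i) => -[|k].
rewrite prod_natr_bool; congr (nat_of_bool _)%:R; apply/subsetP/forallP => [sJ i|sJ i].
  by apply/implyP => phii; apply: sJ; rewrite inE mnmE.
by rewrite inE mnmE; apply: (implyP (sJ i)).
Qed.

Lemma mnm_of_inj m q : injective (@mnm_of m q).
Proof.
move=> phi psi /mnmP E; apply/ffunP => i; apply: val_inj.
by have := E i; rewrite !mnmE.
Qed.

Lemma mdeg_mnm_of m q (phi : {ffun 'I_m -> 'I_q.+1}) :
  (mdeg (mnm_of phi) == q) = (phi \in exponents m q).
Proof. by rewrite mdegE inE; congr (_ == _); apply: eq_bigr => i _; rewrite mnmE. Qed.

Lemma mnm_of_surj m q (e : 'X_{1..m}) : mdeg e = q ->
  exists phi : {ffun 'I_m -> 'I_q.+1}, mnm_of phi = e.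
Proof.
move=> eq; exists [ffun i => inord (e i)]; apply/mnmP => i; rewrite mnmE ffunE inordK //.
by rewrite ltnS -eq mdegE (bigD1 i) //= leq_addr.
Qed.

End FpsCoefficients.
(** * Dimensions of the bigraded pieces *)

Section Dimensions.
Variables (K : fieldType) (V : vectType K) (Delta : {fset 'Hom(V, K^o)}).
Variables (n : nat) (al : 'I_n -> 'Hom(V, K^o)).
Hypothesis alP : forall a, a \in Delta <-> exists i, al i = a.
Hypothesis al_neq0 : forall i, al i != 0.
Local Notation l := (\dim {:V}).
Local Notation idx := ('X_{1..n} * 'X_{1..l})%type.

(** The box [nbc_box] without its corner of bidegree exactly [(p, q)]. *)
Definition nbc_below p q : pred idx := fun t =>
  nbc_box al p q t && ((mdeg t.2 < p) || (mdeg t.1 < q))%N.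

Lemma Rfil_predl (p q : nat) x : Rfil Delta (p%:Z - 1) q x <->
  kspan (fam (nbc_frac al) (fun t => nbc_box al p q t && (mdeg t.2 < p)%N)) x.
Proof.
case: p => [|p].
  split=> [->|[m [c [y [yP ->]]]]]; first exact: kspan0.
  by rewrite big1 // => i _; have [t [/andP[_]]] := yP i; rewrite ltn0.
have -> : p.+1%:Z - 1 = p by lia.
split=> [/(RfilP alP al_neq0)|xP]; last apply/(RfilP alP al_neq0).
  apply: kspan_sub => y [t [/and3P[t1 t2 t3] ->]]; apply: kspan_in; exists t.
  by rewrite /nbc_box t1 t3 ltnS t2 leqW.
move: xP; apply: kspan_sub => y [t [/andP[/and3P[t1 _ t3] t2] ->]].
by apply: kspan_in; exists t; rewrite /nbc_box t1 t3 -ltnS t2.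
Qed.

Lemma Rfil_predr (p q : nat) x : Rfil Delta p (q%:Z - 1) x <->
  kspan (fam (nbc_frac al) (fun t => nbc_box al p q t && (mdeg t.1 < q)%N)) x.
Proof.
case: q => [|q].
  split=> [->|[m [c [y [yP ->]]]]]; first exact: kspan0.
  by rewrite big1 // => i _; have [t [/andP[_]]] := yP i; rewrite ltn0.
have -> : q.+1%:Z - 1 = q by lia.
split=> [/(RfilP alP al_neq0)|xP]; last apply/(RfilP alP al_neq0).
  apply: kspan_sub => y [t [/and3P[t1 t2 t3] ->]]; apply: kspan_in; exists t.
  by rewrite /nbc_box t1 t2 ltnS t3 leqW.
move: xP; apply: kspan_sub => y [t [/andP[/and3P[t1 t2 _] t3] ->]].
by apply: kspan_in; exists t; rewrite /nbc_box t1 t2 -ltnS t3.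
Qed.

Lemma Rfil_lowerP (p q : nat) x :
  Rfil_lower Delta p q x <-> kspan (fam (nbc_frac al) (nbc_below p q)) x.
Proof.
split=> [[u [w [/Rfil_predl uP /Rfil_predr wP ->]]]|].
  apply: kspanD; [move: uP | move: wP];
    apply: kspan_sub => y [t [/andP[tb td] ->]]; apply: kspan_in; exists t;
    by rewrite /nbc_below tb td ?orbT.
case=> m [c [y [yP ->]]].
have [t tP] := choice yP.
exists (\sum_(i < m | (mdeg (t i).2 < p)%N) c i *: y i).
exists (\sum_(i < m | ~~ (mdeg (t i).2 < p)%N) c i *: y i).
split; last exact: bigID.
  apply/Rfil_predl/kspan_sum => i _ ti; apply/kspanZ/kspan_in; exists (t i).
  by have [/andP[tb _] yE] := tP i; rewrite tb ti.
apply/Rfil_predr/kspan_sum => i _ ti; apply/kspanZ/kspan_in; exists (t i).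
by have [/andP[tb] + yE] := tP i; rewrite tb (negPf ti).
Qed.

Definition idx_of p q
    (t : {ffun 'I_n -> 'I_q.+1} * {ffun 'I_l -> 'I_p.+1}) : idx :=
  (mnm_of t.1, mnm_of t.2).

Definition graded_idx p q :
    {set {ffun 'I_n -> 'I_q.+1} * {ffun 'I_l -> 'I_p.+1}} :=
  [set t in setX (exponents n q) (exponents l p) | nbc_idx al (idx_of t)].

Lemma mem_graded_idx p q t : (t \in graded_idx p q) =
  [&& mdeg (mnm_of t.1) == q, mdeg (mnm_of t.2) == p & nbc_idx al (idx_of t)].
Proof. by case: t => phi psi; rewrite /graded_idx in_set in_setX !mdeg_mnm_of andbA. Qed.

Lemma Rbar_has_dim (p q : nat) :
  quot_has_dim (Rfil Delta p q) (Rfil_lower Delta p q) #|graded_idx p q|.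
Proof.
pose s := [seq idx_of t | t <- enum (graded_idx p q)].
have -> : #|graded_idx p q| = size s by rewrite size_map -cardE.
have idx_inj : injective (@idx_of p q).
  move=> [a b] [a' b'] E; congr (_, _); apply: mnm_of_inj.
    exact: (congr1 fst E).
  exact: (congr1 snd E).
apply: (@quot_has_dim_fam _ _ _ (nbc_frac al) _ _ (nbc_box al p q) (nbc_below p q)).
- move=> r c ur rG; apply: lin_indep_nbc => //.
  by apply: sub_all rG => t /and3P[].
- by move=> t /andP[].
- by rewrite map_inj_uniq ?enum_uniq.
- move=> t; apply/mapP/idP => [[u]|].
    rewrite mem_enum mem_graded_idx => /and3P[/eqP d1 /eqP d2 nb] ->.
    by rewrite /nbc_below /nbc_box nb /= d1 d2 !leqnn !ltnn.
  rewrite /nbc_below /nbc_box => /andP[/and3P[nb t2 t1]].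
  rewrite nb t1 t2 /= negb_or -!leqNgt => /andP[t2' t1'].
  have [phi E1] := @mnm_of_surj _ q t.1 (anti_leq (introT andP (conj t1 t1'))).
  have [psi E2] := @mnm_of_surj _ p t.2 (anti_leq (introT andP (conj t2 t2'))).
  exists (phi, psi); last by rewrite /idx_of E1 E2 -surjective_pairing.
  rewrite mem_enum mem_graded_idx /idx_of /= E1 E2 -surjective_pairing nb andbT.
  by rewrite !eqn_leq t1 t1' t2 t2'.
- by move=> x; apply: RfilP.
- by move=> x; apply: Rfil_lowerP.
Qed.

Lemma Rbar_findim_all (p q : int) : Rbar_findim Delta p q.
Proof.
have triv : (forall x, Rfil Delta p q x -> x = 0) -> Rbar_findim Delta p q.
  move=> R0; exists 0%N, (fun=> 0); split=> [[]//|u /R0->|c _ []//].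
  exists (fun=> 0); rewrite big_ord0 subr0; exists 0, 0.
  by split; rewrite ?addr0 //; apply: Rfil0.
case: p triv => [p|p]; case: q => [q|q] triv; [|exact: triv..].
by exists #|graded_idx p q|; apply: Rbar_has_dim.
Qed.

Lemma Rbar_dimE (p q : nat) : Rbar_dim Delta p q = #|graded_idx p q|.
Proof.
apply: quot_dim_eq; last exact: Rbar_has_dim.
  exact/Rfil_lowerP/kspan0.
move=> c u v /Rfil_lowerP uP /Rfil_lowerP vP; apply/Rfil_lowerP.
by apply: kspanD => //; apply: kspanZ.
Qed.

(** Once the support [B] of the denominator is fixed, its exponents and those of
    the numerator vary independently: the former are positive on [B], the latter
    arbitrary on [coords B], which has [l - #|B|] elements. *)
Lemma card_graded_idx p q : (#|graded_idx p q|)%:R =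
  \sum_(B : {set 'I_n} | nbc al B)
    (fps_geom int ^+ (l - #|B|)) p * (fps_pos int ^+ #|B|) q :> int.
Proof.
rewrite -sum1_card natr_sum.
rewrite (partition_big (fun t => supp (mnm_of t.1)) (nbc al)) /=; last first.
  by move=> t; rewrite mem_graded_idx => /and3P[_ _ /andP[]].
apply: eq_bigr => B nB.
have <- : #|coords al B| = (l - #|B|)%N by rewrite card_free_coords rank_span_nbc.
rewrite -card_supp_eq -card_supp_sub -natrM mulnC -cardsX -sum1_card natr_sum.
apply: eq_bigl => -[phi psi].
rewrite in_setX !inE /nbc_idx /=.
case: (supp (mnm_of phi) =P B) => [->|_]; last by rewrite !andbF.
by rewrite nB andbT /= !andbT andbA.
Qed.

End Dimensions.

Lemma nth_fsetP (T : choiceType) (x0 : T) (A : {fset T}) a :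
  a \in A <-> exists i : 'I_(size (enum_fset A)), nth x0 (enum_fset A) i = a.
Proof.
split=> [aA|[i <-]]; last by rewrite mem_nth.
by have /(nthP x0)[i lti <-] := aA; exists (Ordinal lti).
Qed.

Lemma sub_s_inv : (1 - ps_s)^-1 = fpsC (fps_geom int).
Proof.
apply: (mulIr unit_sub_s); rewrite mulVr ?unit_sub_s // -(rmorph1 (@fpsC (fps int))).
by rewrite -rmorphB -rmorphM fps_geomK rmorph1.
Qed.

Theorem theorem1p2 (K : fieldType) (charK : [pchar K] =i pred0)
    (V : vectType K) (l : nat) (dimV : \dim {:V} = l)
    (Delta : {fset 'Hom(V, K^o)})
    (Delta_neq0 : forall a, a \in Delta -> a != 0)
    (Delta_nprop : forall a b, a \in Delta -> b \in Delta -> a != b ->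
       forall c : K, a <> c *: b) :
  (forall p q : int, Rbar_findim Delta p q) /\
  poin_Rbar Delta =
    ((1 - ps_s) ^+ l)^-1 *
      (map_poly intr (poin_arr Delta)).[ps_t * (1 - ps_s) / (1 - ps_t)].
Proof.
pose al (i : 'I_(size (enum_fset Delta))) := nth 0 (enum_fset Delta) i.
have alP a : a \in Delta <-> exists i, al i = a by apply: nth_fsetP.
have al_neq0 i : al i != 0 by apply/Delta_neq0/alP; exists i.
split; first exact: (Rbar_findim_all alP al_neq0).
rewrite (poin_arr_nbc alP al_neq0) rmorph_sum horner_sum mulr_sumr.
have termE B : nbc al B ->
    ((1 - ps_s) ^+ l)^-1 *
      (map_poly intr 'X^#|B|).[ps_t * (1 - ps_s) / (1 - ps_t)] =
    fpsC (fps_geom int ^+ (l - #|B|)) * fps_pos (fps int) ^+ #|B| :> fps2.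
  move=> nB; have leB : (#|B| <= l)%N.
    by rewrite -(codim_flat_nbc nB) /codim dimV leq_subr.
  rewrite map_polyXn hornerXn -exprVn sub_s_inv mulrAC exprMn -fps_posE.
  rewrite -{1}(subnK leB) exprD -!mulrA rmorphXn; congr (_ * _).
  rewrite mulrC -mulrA -exprMn -sub_s_inv mulrV ?unit_sub_s //.
  by rewrite expr1n mulr1.
rewrite (eq_bigr _ termE); apply: fpsP => q; rewrite fcoef_sum; apply: fpsP => p.
rewrite fcoef_sum [LHS]/= (Rbar_dimE alP al_neq0) -[Posz _]natz card_graded_idx dimV.
apply: eq_bigr => B _; rewrite fcoefCM -!card_supp_eq.
by rewrite [X in _ = fcoef X p]mulr_natr fcoefMn mulr_natr.
Qed.
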